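(* For every infinite field $K$, the theory $T_K$ is totally transcendental.
   Context: Let $K$ be an infinite field. Let $L_{K\text{-vs}} = \{+,0,\lambda\cdot \mid \lambda\in K\}$ be the language of $K$-vector spaces, and let $L_K$ be $L_{K\text{-vs}}$ together with unary predicates $X^n$ for $n\in\omega$; write $X := X^1$. The $L_K$-theory $T_K$ is axiomatised as follows. (1) The reduct to $L_{K\text{-vs}}$ is a $K$-vector space. (2) $X$ is closed under multiplication by every $\lambda\in K$. (3) Each $X^n$ is interpreted as the $n$-fold sum $\{x_0+\dots+x_{n-1}\mid x_j\in X\}$, with the convention $X^0=\{0\}$. (4) The parallelism relation $x\parallel y :\Leftrightarrow x+y\in X$ is an equivalence relation on $X\setminus\{0\}$; the union of an equivalence class with $\{0\}$ is called an axis. (5) There are infinitely many axes. (6) The axes are linearly independent: if $Y_0,\dots,Y_n$ are pairwise distinct axes and $a_i\in Y_i\setminus\{0\}$, then $a_0,\dots,a_n$ are linearly independent. Totally transcendental has its usual meaning (every formula has ordinal-valued Morley rank); equivalently, every reduct to a countable sublanguage is $\omega$-stable. *)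

(* Defs.v *)
From mathcomp Require Import all_boot all_order all_algebra.
From mathcomp Require Import boolp classical_sets functions cardinality.

Set Implicit Arguments.
Unset Strict Implicit.
Unset Printing Implicit Defensive.

Import GRing.Theory.

Local Open Scope classical_set_scope.

(** * First-order logic *)

Record language := Language {
  fsym : Type;
  rsym : Type;
  farity : fsym -> nat;
  rarity : rsym -> nat }.

Section Syntax.
Variable L : language.

(* The variables x_0, x_1, ... are named by natural numbers. *)
Inductive term : Type :=
| tVar of nat
| tApp (f : fsym L) of ('I_(farity f) -> term).

Inductive formula : Type :=
| fFalse
| fEq of term & term
| fRel (r : rsym L) of ('I_(rarity r) -> term)
| fImp of formula & formula
| fAll of nat & formula.

Definition fNot p := fImp p fFalse.
Definition fTrue := fNot fFalse.
Definition fAnd p q := fNot (fImp p (fNot q)).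
Definition fIff p q := fAnd (fImp p q) (fImp q p).
Definition fEx x p := fNot (fAll x (fNot p)).

(* Quantification over x_m, ..., x_(m + n - 1). *)
Definition fAlls m n p := foldr fAll p (iota m n).
Definition fExs m n p := foldr fEx p (iota m n).

Fixpoint occurs (x : nat) (t : term) : Prop :=
  match t with
  | tVar y => x = y
  | tApp f ts => exists i, occurs x (ts i)
  end.

Fixpoint free (x : nat) (p : formula) : Prop :=
  match p with
  | fFalse => False
  | fEq t u => occurs x t \/ occurs x u
  | fRel r ts => exists i, occurs x (ts i)
  | fImp p q => free x p \/ free x q
  | fAll y p => x <> y /\ free x p
  end.

Definition sentence (p : formula) : Prop := forall x, ~ free x p.

End Syntax.

Arguments tVar {L}.
Arguments tApp {L}.
Arguments fFalse {L}.
Arguments fTrue {L}.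
Arguments fRel {L}.

Record structure (L : language) := Structure {
  carrier :> Type;
  finterp : forall f : fsym L, ('I_(farity f) -> carrier) -> carrier;
  rinterp : forall r : rsym L, ('I_(rarity r) -> carrier) -> Prop }.

Section Semantics.
Variables (L : language) (M : structure L).

Definition upd (v : nat -> M) (x : nat) (a : M) : nat -> M :=
  fun y => if y == x then a else v y.

Fixpoint eval (v : nat -> M) (t : term L) : M :=
  match t with
  | tVar x => v x
  | tApp f ts => finterp (fun i => eval v (ts i))
  end.

Fixpoint sat (v : nat -> M) (p : formula L) : Prop :=
  match p with
  | fFalse => False
  | fEq t u => eval v t = eval v u
  | fRel r ts => rinterp (fun i => eval v (ts i))
  | fImp p q => sat v p -> sat v q
  | fAll x p => forall a, sat (upd v x a) p
  end.

Definition models (T : set (formula L)) : Prop :=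
  forall p, T p -> forall v, sat v p.

(* Every set of formulas p(x_m, b_0, ..., b_(m - 1)) with parameters in a
   finite subset {b_0, ..., b_(m - 1)} of M that is finitely satisfiable in M
   is realised in M. *)
Definition omega_saturated : Prop :=
  forall (m : nat) (b : nat -> M) (G : set (formula L)),
    (forall p, G p -> forall x, free x p -> x <= m) ->
    (forall (k : nat) (s : 'I_k -> formula L), (forall i, G (s i)) ->
       exists a, forall i, sat (upd b m a) (s i)) ->
    exists a, forall p, G p -> sat (upd b m a) p.

(* An L(M)-formula p(x_0, ..., x_(n - 1)): a formula together with an
   assignment of parameters of M to its variables; for any given n the
   parameters of x_0, ..., x_(n - 1) are ignored. *)
Record pformula := PFormula {
  pf_formula : formula L;
  pf_param : nat -> M }.

Definition psat n (p : pformula) (a : 'I_n -> M) : Prop :=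
  sat (fun x => if insub x is Some i then a i else pf_param p x)
      (pf_formula p).

Definition consistent n (p : pformula) : Prop :=
  exists a : 'I_n -> M, psat p a.

End Semantics.

(** * Morley rank *)

(* Notations for ordinals; oSup denotes the supremum of a family.  Every
   ordinal (below the universe) has a notation. *)
Inductive ord : Type :=
| oZero
| oSucc of ord
| oSup (A : Type) of (A -> ord).

(* MR p >= o, for p an L(M)-formula in x_0, ..., x_(n - 1), computed in M. *)
Fixpoint MR_ge (L : language) (M : structure L) (n : nat) (o : ord)
    (p : pformula M) : Prop :=
  match o with
  | oZero => consistent n p
  | oSucc o' => exists q : nat -> pformula M,
      [/\ forall i (a : 'I_n -> M), psat (q i) a -> psat p a,
          forall i j, i <> j -> forall a : 'I_n -> M,
            ~ (psat (q i) a /\ psat (q j) a)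
        & forall i, MR_ge n o' (q i)]
  | oSup A f => consistent n p /\ forall x : A, MR_ge n (f x) p
  end.

Definition MR_eq (L : language) (M : structure L) (n : nat) (p : pformula M)
    (o : ord) : Prop :=
  MR_ge n o p /\ ~ MR_ge n (oSucc o) p.

(* The Morley rank of a formula is its rank computed in omega-saturated
   models; inconsistent formulas have rank -oo. *)
Definition totally_transcendental (L : language) (T : set (formula L)) : Prop :=
  forall M : structure L, models M T -> omega_saturated M ->
  forall (n : nat) (p : pformula M), consistent n p ->
  exists o : ord, MR_eq n p o.

(** * The theory T_K *)

Definition noarg (A : Type) (i : 'I_0) : A :=
  let: Ordinal _ lt_i0 := i in False_rect A (notF lt_i0).

Section TK.
Variable K : fieldType.

Inductive LK_fsym : Type := Add | Zero | Scale of K.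

(* The relation symbol n : nat is the predicate X^n. *)
Definition LK : language := {|
  fsym := LK_fsym;
  rsym := nat;
  farity := fun f => match f with Add => 2 | Zero => 0 | Scale _ => 1 end;
  rarity := fun _ => 1 |}.

Definition tadd (t u : term LK) : term LK :=
  tApp (Add : fsym LK) (fun i => if val i == 0 then t else u).
Definition tzero : term LK := tApp (Zero : fsym LK) (@noarg (term LK)).
Definition tscale (c : K) (t : term LK) : term LK :=
  tApp (Scale c : fsym LK) (fun _ => t).
Definition fX (n : nat) (t : term LK) : formula LK :=
  fRel (n : rsym LK) (fun _ => t).

Definition fnzX (t : term LK) : formula LK :=
  fAnd (fX 1 t) (fNot (fEq t tzero)).
Definition fpar (t u : term LK) : formula LK := fX 1 (tadd t u).

(* x_0, ..., x_(n - 1) are nonzero elements of pairwise distinct axes. *)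
Definition fdistinct_axes (n : nat) : formula LK :=
  fAnd (\big[@fAnd LK/fTrue]_(i < n) fnzX (tVar i))
       (\big[@fAnd LK/fTrue]_(i < n) \big[@fAnd LK/fTrue]_(j < n | i != j)
          fNot (fpar (tVar i) (tVar j))).

Local Notation x0 := (@tVar LK 0).
Local Notation x1 := (@tVar LK 1).
Local Notation x2 := (@tVar LK 2).

Inductive TK : set (formula LK) :=
| TK_addA : TK (fAlls 0 3
    (fEq (tadd x0 (tadd x1 x2)) (tadd (tadd x0 x1) x2)))
| TK_addC : TK (fAlls 0 2 (fEq (tadd x0 x1) (tadd x1 x0)))
| TK_add0 : TK (fAll 0 (fEq (tadd tzero x0) x0))
| TK_addN : TK (fAll 0 (fEq (tadd (tscale (-1)%R x0) x0) tzero))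
| TK_scaleA (c d : K) : TK (fAll 0
    (fEq (tscale c (tscale d x0)) (tscale (c * d)%R x0)))
| TK_scale1 : TK (fAll 0 (fEq (tscale 1%R x0) x0))
| TK_scaleDr (c : K) : TK (fAlls 0 2
    (fEq (tscale c (tadd x0 x1)) (tadd (tscale c x0) (tscale c x1))))
| TK_scaleDl (c d : K) : TK (fAll 0
    (fEq (tscale (c + d)%R x0) (tadd (tscale c x0) (tscale d x0))))
| TK_scaleX (c : K) : TK (fAll 0 (fImp (fX 1 x0) (fX 1 (tscale c x0))))
| TK_Xn (n : nat) : TK (fAll 0 (fIff (fX n x0) (fExs 1 n
    (fAnd (\big[@fAnd LK/fTrue]_(j < n) fX 1 (tVar j.+1))
          (fEq x0 (\big[tadd/tzero]_(j < n) tVar j.+1))))))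
| TK_par_refl : TK (fAll 0 (fImp (fnzX x0) (fpar x0 x0)))
| TK_par_sym : TK (fAlls 0 2 (fImp (fAnd (fnzX x0) (fnzX x1))
    (fImp (fpar x0 x1) (fpar x1 x0))))
| TK_par_trans : TK (fAlls 0 3
    (fImp (fAnd (fnzX x0) (fAnd (fnzX x1) (fnzX x2)))
      (fImp (fpar x0 x1) (fImp (fpar x1 x2) (fpar x0 x2)))))
| TK_inf_axes (n : nat) : TK (fExs 0 n (fdistinct_axes n))
| TK_indep (n : nat) (c : 'I_n.+1 -> K) (i : 'I_n.+1) : c i <> 0%R ->
    TK (fAlls 0 n.+1 (fImp (fdistinct_axes n.+1)
      (fNot (fEq (\big[tadd/tzero]_(j < n.+1) tscale (c j) (tVar j)) tzero)))).

Lemma free_Alls x m n (p : formula LK) :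
  free x (fAlls m n p) -> free x p /\ ~~ (m <= x < m + n).
Proof.
rewrite /fAlls; elim: n m => [|n IH] m /=.
  by move=> fx; split=> //; rewrite addn0; case: ltngtP.
case=> /eqP xm /IH[fx]; rewrite addSnnS => H; split=> //.
by apply: contra H => /andP[mx ->]; rewrite andbT ltn_neqAle eq_sym xm.
Qed.

Lemma free_Exs x m n (p : formula LK) :
  free x (fExs m n p) -> free x p /\ ~~ (m <= x < m + n).
Proof.
rewrite /fExs; elim: n m => [|n IH] m /=.
  by move=> fx; split=> //; rewrite addn0; case: ltngtP.
case=> // -[/eqP xm [|//]] /IH[fx]; rewrite addSnnS => H; split=> //.
by apply: contra H => /andP[mx ->]; rewrite andbT ltn_neqAle eq_sym xm.
Qed.

Lemma free_And x p q : free x (@fAnd LK p q) -> free x p \/ free x q.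
Proof. by rewrite /=; tauto. Qed.

Lemma free_bigAnd x n (P : pred 'I_n) (F : 'I_n -> formula LK) :
  free x (\big[@fAnd LK/fTrue]_(i < n | P i) F i) -> exists i, free x (F i).
Proof.
elim/big_rec: _ => [[]//|i p _ IH /free_And[]]; [by exists i|exact: IH].
Qed.

Lemma occurs_add x t u : occurs x (tadd t u) -> occurs x t \/ occurs x u.
Proof. by case=> i /=; case: ifP; [left|right]. Qed.

Lemma occurs_zero x : ~ occurs x tzero.
Proof. by case=> -[]. Qed.

Lemma occurs_sum x n (F : 'I_n -> term LK) :
  occurs x (\big[tadd/tzero]_(i < n) F i) -> exists i, occurs x (F i).
Proof.
elim/big_rec: _ => [/occurs_zero//|i t _ IH /occurs_add[]]; last exact: IH.
by exists i.
Qed.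

Lemma free_X x n t : free x (fX n t) -> occurs x t.
Proof. by case. Qed.

Lemma free_nzX x t : free x (fnzX t) -> occurs x t.
Proof. by move=> /free_And[/free_X//|[[//|/occurs_zero]|]]. Qed.

Lemma free_par x t u : free x (fpar t u) -> occurs x t \/ occurs x u.
Proof. by move=> /free_X/occurs_add. Qed.

Lemma free_distinct_axes x n : free x (fdistinct_axes n) -> x < n.
Proof.
move=> /free_And[/free_bigAnd[i /free_nzX /= ->]|]; first exact: ltn_ord.
move=> /free_bigAnd[i /free_bigAnd[j [|//]]].
by move=> /free_par[] /= ->; exact: ltn_ord.
Qed.

Lemma free_Imp x (p q : formula LK) : free x (fImp p q) -> free x p \/ free x q.
Proof. by []. Qed.

Lemma free_All x y (p : formula LK) : free x (fAll y p) -> x <> y /\ free x p.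
Proof. by []. Qed.

Lemma free_Eq x (t u : term LK) : free x (fEq t u) -> occurs x t \/ occurs x u.
Proof. by []. Qed.

Lemma occurs_scale x c t : occurs x (tscale c t) -> occurs x t.
Proof. by case. Qed.

Lemma occurs_Var x y : occurs x (@tVar LK y) -> x = y.
Proof. by []. Qed.

Ltac free_vars := repeat match goal with
  | H : _ \/ _ |- _ => destruct H
  | H : _ /\ _ |- _ => destruct H
  | H : is_true (~~ (_ <= ?x < _)), E : ?x = _ |- _ => by rewrite E in H
  | H : ?x <> ?y, E : ?x = ?y |- _ => by case: (H E)
  | H : occurs _ tzero |- _ => by case: (occurs_zero H)
  | H : occurs _ (tVar _) |- _ => move/occurs_Var in H
  | H : occurs _ (tadd _ _) |- _ => move/occurs_add in H
  | H : occurs _ (tscale _ _) |- _ => move/occurs_scale in H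
  | H : free _ (fAlls _ _ _) |- _ => move/free_Alls in H
  | H : free _ (fAll _ _) |- _ => move/free_All in H
  | H : free _ (fnzX _) |- _ => move/free_nzX in H
  | H : free _ (fpar _ _) |- _ => move/free_par in H
  | H : free _ (fX _ _) |- _ => move/free_X in H
  | H : free _ (fAnd _ _) |- _ => move/free_And in H
  | H : free _ (fImp _ _) |- _ => move/free_Imp in H
  | H : free _ (fEq _ _) |- _ => move/free_Eq in H
  end.

Lemma TK_sentence p : TK p -> sentence p.
Proof.
case=> [||||c d||c|c d|c|n||||n|n c i ci] x fx; try by free_vars.
- have [xn0] := free_All fx.
  have Xx0 : ~ free x (fX n x0) by move=> /free_X.
  have Exx0 : ~ free x (fExs 1 n
      (fAnd (\big[@fAnd LK/fTrue]_(j < n) fX 1 (tVar j.+1))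
            (fEq x0 (\big[tadd/tzero]_(j < n) tVar j.+1)))).
    move=> /free_Exs[fx' /negP]; apply.
    suff [j ->] : exists j : 'I_n, x = j.+1 by rewrite add1n !ltnS ltn_ord.
    case/free_And: fx' => [/free_bigAnd[j /free_X xj]|]; first by exists j.
    by case/free_Eq=> [//|/occurs_sum[j xj]]; exists j.
  by case/free_And=> /free_Imp[].
- by have [/free_distinct_axes xn] := free_Exs fx; rewrite /= xn.
- have [fx'] := free_Alls fx; rewrite leq0n add0n /= => /negP; apply.
  case/free_Imp: fx' => [/free_distinct_axes //|/free_Imp[|//]].
  case/free_Eq=> [/occurs_sum[j /occurs_scale/= ->]|/occurs_zero//].
  exact: ltn_ord.
Qed.

(** ** The models of T_K in terms of axes *)

Section Models.
Variable M : structure LK.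

Definition vadd (a b : M) : M :=
  finterp (f := Add : fsym LK) (fun i => if val i == 0 then a else b).
Definition vzero : M :=
  finterp (f := Zero : fsym LK) (@noarg M).
Definition vscale (c : K) (a : M) : M :=
  finterp (f := Scale c : fsym LK) (fun _ => a).
Definition mX (n : nat) : set M :=
  [set a | rinterp (r := n : rsym LK) (fun _ => a)].

Definition nzX : set M := [set a | mX 1 a /\ a <> vzero].
Definition parallel (a b : M) : Prop := mX 1 (vadd a b).

Definition axis (Y : set M) : Prop :=
  exists2 a, nzX a & Y = [set b | b = vzero \/ (nzX b /\ parallel a b)].

Record vector_space : Prop := {
  vaddA : associative vadd;
  vaddC : commutative vadd;
  vadd0 : left_id vzero vadd;
  vaddN : forall a, vadd (vscale (-1)%R a) a = vzero;
  vscaleA : forall c d a, vscale c (vscale d a) = vscale (c * d)%R a;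
  vscale1 : forall a, vscale 1%R a = a;
  vscaleDr : forall c a b, vscale c (vadd a b) = vadd (vscale c a) (vscale c b);
  vscaleDl : forall c d a, vscale (c + d)%R a = vadd (vscale c a) (vscale d a) }.

Record TK_axioms : Prop := {
  ax_vs : vector_space;
  ax_scaleX : forall c a, mX 1 a -> mX 1 (vscale c a);
  ax_Xn : forall n a, mX n a <->
    exists2 x : 'I_n -> M, forall j, mX 1 (x j) &
                           a = \big[vadd/vzero]_(j < n) x j;
  ax_par_refl : forall a, nzX a -> parallel a a;
  ax_par_sym : forall a b, nzX a -> nzX b -> parallel a b -> parallel b a;
  ax_par_trans : forall a b c, nzX a -> nzX b -> nzX c ->
    parallel a b -> parallel b c -> parallel a c;
  ax_inf_axes : infinite_set axis;
  ax_indep : forall n (Y : 'I_n.+1 -> set M) (a : 'I_n.+1 -> M),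
    (forall i, axis (Y i)) -> injective Y ->
    (forall i, Y i (a i) /\ a i <> vzero) ->
    forall c : 'I_n.+1 -> K,
      \big[vadd/vzero]_(i < n.+1) vscale (c i) (a i) = vzero ->
      forall i, c i = 0%R }.

End Models.

Section Adequacy.
Variable M : structure LK.
Implicit Types v : nat -> M.

Lemma sat_Not v p : sat v (fNot p) <-> ~ sat v p.
Proof. by []. Qed.

Lemma sat_True v : sat v fTrue.
Proof. by []. Qed.

Lemma sat_And v p q : sat v (fAnd p q) <-> sat v p /\ sat v q.
Proof.
split=> [H|[Hp Hq] H]; last exact: H.
have {}H : ~ (sat v p -> ~ sat v q) := H.
by split; apply: contrapT => N; apply: H => Hp Hq; apply: N.
Qed.

Lemma sat_Iff v p q : sat v (fIff p q) <-> (sat v p <-> sat v q).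
Proof.
exact: (sat_And v (fImp p q) (fImp q p)).
Qed.

Lemma sat_Ex v x p : sat v (fEx x p) <-> exists a, sat (upd v x a) p.
Proof.
split=> [H|[a Ha] H]; last exact: (H a).
have {}H : ~ forall a, ~ sat (upd v x a) p := H.
by apply: contrapT => N; apply: H => a Ha; apply: N; exists a.
Qed.

Lemma sat_bigAnd v n (P : pred 'I_n) (F : 'I_n -> formula LK) :
  sat v (\big[@fAnd LK/fTrue]_(i < n | P i) F i) <->
  forall i, P i -> sat v (F i).
Proof.
suff H (s : seq 'I_n) : sat v (\big[@fAnd LK/fTrue]_(i <- s | P i) F i) <->
    forall i, i \in s -> P i -> sat v (F i).
  rewrite H; split=> Q i; last by move=> _; exact: Q.
  by apply: Q; rewrite mem_index_enum.
elim: s => [|j s IH]; first by rewrite big_nil; split=> // _; exact: sat_True.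
rewrite big_cons; case: ifP => Pj; last first.
  rewrite IH; split=> Q i si Pi; last by apply: Q; rewrite ?inE ?si ?orbT.
  by move: si; rewrite inE => /orP[/eqP E|/Q]; [rewrite -E Pi in Pj | apply].
rewrite sat_And IH; split=> [[Hj Q] i|Q].
  by rewrite inE => /orP[/eqP->|/Q].
by split=> [|i si Pi]; apply: Q => //; rewrite inE ?eqxx ?si ?orbT.
Qed.

(* Simultaneous update of x_m, ..., x_(m + n - 1). *)
Definition upds v m n (f : nat -> M) : nat -> M :=
  fun y => if m <= y < m + n then f (y - m) else v y.

Lemma upds0 v m f : upds v m 0 f = v.
Proof. by apply/funext => y; rewrite /upds addn0; case: ltngtP. Qed.

Lemma updsS v m n f :
  upds v m n.+1 f = upds (upd v m (f 0)) m.+1 n (fun i => f i.+1).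
Proof.
apply/funext => y; rewrite /upds /upd addnS addSn ltnS.
case: (ltngtP m y) => [my|//|<-] /=; last by rewrite leq_addr subnn.
by rewrite -subSn // subSS.
Qed.

Lemma sat_Alls v m n p : sat v (fAlls m n p) <-> forall f, sat (upds v m n f) p.
Proof.
rewrite /fAlls; elim: n m v => [|n IH] m v /=.
  by split=> [H f|/(_ v)]; rewrite upds0.
split=> [H f|H a]; first by rewrite updsS; move/IH: (H (f 0)); apply.
apply/IH => f; have := H (fun i => if i is j.+1 then f j else a).
by rewrite updsS.
Qed.

Lemma sat_Exs v m n p : sat v (fExs m n p) <-> exists f, sat (upds v m n f) p.
Proof.
rewrite /fExs; elim: n m v => [|n IH] m v.
  by split=> [H|[f]]; [exists v|]; rewrite upds0.
rewrite [foldr _ _ _]/= sat_Ex; split=> [[a /IH[f H]]|[f]].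
  by exists (fun i => if i is j.+1 then f j else a); rewrite updsS.
by rewrite updsS => H; exists (f 0); apply/IH; exists (fun i => f i.+1).
Qed.

Lemma eval_add v t u : eval v (tadd t u) = vadd (eval v t) (eval v u).
Proof. by congr finterp; apply/funext => i; case: ifP. Qed.

Lemma eval_zero v : eval v tzero = vzero M.
Proof. by congr finterp; apply/funext => -[]. Qed.

Lemma eval_sum v n (F : 'I_n -> term LK) :
  eval v (\big[tadd/tzero]_(i < n) F i) =
  \big[@vadd M/vzero M]_(i < n) eval v (F i).
Proof. exact: (big_morph (eval v) (eval_add v) (eval_zero v)). Qed.

Lemma sat_X v n t : sat v (fX n t) = mX n (eval v t).
Proof. by []. Qed.

Lemma sat_nzX v t : sat v (fnzX t) <-> nzX (eval v t).
Proof. by rewrite sat_And /nzX /= -[vzero M](eval_zero v). Qed.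

Lemma sat_par v t u : sat v (fpar t u) <-> parallel (eval v t) (eval v u).
Proof. by rewrite /fpar sat_X eval_add. Qed.

Lemma sat_distinct_axes v n : sat v (fdistinct_axes n) <->
  (forall i : 'I_n, nzX (v i)) /\
  (forall i j : 'I_n, i != j -> ~ parallel (v i) (v j)).
Proof.
rewrite sat_And !sat_bigAnd; split=> -[H1 H2]; split.
- by move=> i; apply/(sat_nzX v (tVar i)); apply: H1.
- move=> i j ij /(sat_par v (tVar i) (tVar j)).
  by move: (H2 i isT); rewrite sat_bigAnd => /(_ j ij).
- by move=> i _; apply/sat_nzX; apply: H1.
- by move=> i _; apply/sat_bigAnd => j ij /sat_par; apply: H2.
Qed.

Section Axes.
Hypothesis prefl : forall a : M, nzX a -> parallel a a.
Hypothesis psym : forall a b : M, nzX a -> nzX b -> parallel a b -> parallel b a.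
Hypothesis ptrans : forall a b c : M, nzX a -> nzX b -> nzX c ->
  parallel a b -> parallel b c -> parallel a c.

Definition axis_of (a : M) : set M :=
  [set b | b = vzero M \/ (nzX b /\ parallel a b)].

Lemma axis_of_axis a : nzX a -> axis (axis_of a).
Proof. by exists a. Qed.

Lemma axis_of_eq a b : nzX a -> nzX b ->
  (axis_of a = axis_of b) <-> parallel a b.
Proof.
move=> Xa Xb; split=> [E|ab].
  have : axis_of b b by right; split=> //; apply: prefl.
  by rewrite -E => -[b0|[]//]; case: Xb => _ /(_ b0).
have ba := psym Xa Xb ab.
apply/seteqP; split=> c [c0|[Xc pc]]; [by left|right|by left|right].
  by split=> //; apply: ptrans pc.
by split=> //; apply: ptrans pc.
Qed.

Lemma axis_mem Y a : axis Y -> Y a -> a <> vzero M -> nzX a /\ Y = axis_of a.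
Proof.
case=> b Xb -> [//|[Xa ba]] _; split=> //.
by apply/axis_of_eq.
Qed.

Lemma inf_axesP : infinite_set (@axis M) <->
  forall n, exists2 f : nat -> M, forall i : 'I_n, nzX (f i) &
    forall i j : 'I_n, i != j -> ~ parallel (f i) (f j).
Proof.
split=> [/infiniteP/pcard_leP[g] n|H].
  have ax i : axis (g i) by exact: funS.
  have /choice[f Hf] i : exists a, nzX a /\ g i = axis_of a.
    by have [a Xa ->] := ax i; exists a.
  exists f => [i|i j ij /axis_of_eq]; first by case: (Hf i).
  have [Xi Ei] := Hf i; have [Xj Ej] := Hf j => /(_ Xi Xj) E.
  move/eqP: ij; apply; apply: val_inj.
  by apply: (@inj _ _ _ g); rewrite ?in_setT //; etransitivity; [exact: Ei|rewrite E; exact: esym Ej].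
move=> /finite_set_leP[n le_n]; have [f f1 f2] := H n.+1.
suff le1 : (`I_n.+1 #<= @axis M)%card.
  by have := card_le_trans le1 le_n; rewrite card_le_II ltnn.
have inj_g : {in `I_n.+1 &, injective (axis_of \o f)}.
  move=> i j /set_mem/= li /set_mem/= lj /= E; apply/eqP.
  apply: contrapT => /negP ij.
  have := f2 (Ordinal li) (Ordinal lj) ij; apply.
  exact/(axis_of_eq (f1 (Ordinal li)) (f1 (Ordinal lj))).
have g_axis : (axis_of \o f) @` `I_n.+1 `<=` @axis M.
  by move=> _ [i li <-]; apply: axis_of_axis; apply: (f1 (Ordinal li)).
rewrite -(card_le_eql (inj_card_eq inj_g)).
exact: subset_card_le.
Qed.

Lemma indepP n : (forall (Y : 'I_n.+1 -> set M) (a : 'I_n.+1 -> M),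
    (forall i, axis (Y i)) -> injective Y ->
    (forall i, Y i (a i) /\ a i <> vzero M) ->
    forall c : 'I_n.+1 -> K,
      \big[@vadd M/vzero M]_(i < n.+1) vscale (c i) (a i) = vzero M ->
      forall i, c i = 0%R) <->
  forall (a : nat -> M), (forall i : 'I_n.+1, nzX (a i)) ->
    (forall i j : 'I_n.+1, i != j -> ~ parallel (a i) (a j)) ->
    forall c : 'I_n.+1 -> K,
      \big[@vadd M/vzero M]_(i < n.+1) vscale (c i) (a i) = vzero M ->
      forall i, c i = 0%R.
Proof.
split=> H.
  move=> a Xa pa; apply: (H (fun i => axis_of (a i))) => [i|i j E|i].
  - exact: axis_of_axis.
  - apply/eqP; apply: contrapT => /negP /pa; apply.
    exact/axis_of_eq.
  - by split; [right; split=> //; exact: prefl|case: (Xa i)].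
move=> Y a axY injY Ya c E.
pose b i := if insub i is Some j then a j else vzero M.
have bE (i : 'I_n.+1) : b i = a i by rewrite /b valK.
have HY i : nzX (a i) /\ Y i = axis_of (a i).
  by have [? ?] := Ya i; apply: axis_mem.
apply: (H b) => [i|i j ij|].
- by rewrite bE; case: (HY i).
- rewrite !bE; have [Xi Ei] := HY i; have [Xj Ej] := HY j.
  move=> /(axis_of_eq Xi Xj); rewrite -Ei -Ej => /injY ijE.
  by rewrite ijE eqxx in ij.
- by rewrite -[RHS]E; apply: eq_bigr => i _; rewrite bE.
Qed.

End Axes.

Lemma upds_lt v n f (i : 'I_n) : upds v 0 n f i = f i.
Proof. by rewrite /upds add0n ltn_ord subn0. Qed.

Lemma sat_Xn v a n f : sat (upds (upd v 0 a) 1 n f)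
    (fAnd (\big[@fAnd LK/fTrue]_(j < n) fX 1 (tVar j.+1))
          (fEq x0 (\big[tadd/tzero]_(j < n) tVar j.+1))) <->
  (forall j : 'I_n, mX 1 (f j)) /\ a = \big[@vadd M/vzero M]_(j < n) f j.
Proof.
have fE (j : 'I_n) : upds (upd v 0 a) 1 n f j.+1 = f j.
  by rewrite /upds add1n ltnS ltnS ltn_ord subSS subn0.
rewrite sat_And sat_bigAnd [sat _ (fEq _ _)]/= eval_sum.
under eq_bigr do rewrite [eval _ _]/= fE.
split=> -[H E]; split=> // j; last by rewrite sat_X /= fE.
by have := H j isT; rewrite sat_X /= fE.
Qed.

Lemma sat_distinct_upds v n f : sat (upds v 0 n f) (fdistinct_axes n) <->
  (forall i : 'I_n, nzX (f i)) /\
  (forall i j : 'I_n, i != j -> ~ parallel (f i) (f j)).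
Proof.
rewrite sat_distinct_axes; split=> -[H1 H2]; split=> [i|i j].
- by have := H1 i; rewrite upds_lt.
- by have := H2 i j; rewrite !upds_lt.
- by rewrite upds_lt.
- by rewrite !upds_lt; apply: H2.
Qed.

Lemma sat_lincomb v n f (c : 'I_n -> K) : sat (upds v 0 n f)
    (fEq (\big[tadd/tzero]_(j < n) tscale (c j) (tVar j)) tzero) <->
  \big[@vadd M/vzero M]_(j < n) vscale (c j) (f j) = vzero M.
Proof.
rewrite [sat _ _]/= eval_sum -[X in _ = X <-> _]/(eval _ tzero) eval_zero.
by under eq_bigr do rewrite [eval _ _]/= upds_lt.
Qed.

Lemma TK_modelsP : models M TK <-> TK_axioms M.
Proof.
have v0 : nat -> M by move=> _; exact: vzero.
pose B n := fAnd (\big[@fAnd LK/fTrue]_(j < n) fX 1 (tVar j.+1))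
                 (fEq x0 (\big[tadd/tzero]_(j < n) tVar j.+1)).
split=> [H|].
  have pr (a : M) : nzX a -> parallel a a.
    have /(_ a) h := H _ TK_par_refl v0.
    by move/(sat_nzX (upd v0 0 a) x0)/h/sat_par.
  have ps (a b : M) : nzX a -> nzX b -> parallel a b -> parallel b a.
    pose f := nth a [:: a; b]; pose v := upds v0 0 2 f.
    have /(sat_Alls v0 0 2)/(_ f) h := H _ TK_par_sym v0.
    move=> Xa Xb /(sat_par v x0 x1) ab; apply/(sat_par v x1 x0).
    apply: (h _ ab); apply/(sat_And v (fnzX x0) (fnzX x1)).
    by split; apply/sat_nzX.
  have pt (a b c : M) : nzX a -> nzX b -> nzX c ->
      parallel a b -> parallel b c -> parallel a c.
    pose f := nth a [:: a; b; c]; pose v := upds v0 0 3 f.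
    have /(sat_Alls v0 0 3)/(_ f) h := H _ TK_par_trans v0.
    move=> Xa Xb Xc /(sat_par v x0 x1) ab /(sat_par v x1 x2) bc.
    apply/(sat_par v x0 x2); apply: (h _ ab bc).
    apply/(sat_And v (fnzX x0) (fAnd (fnzX x1) (fnzX x2))).
    by rewrite sat_And; split; [|split]; apply/sat_nzX.
  split=> //.
  - split=> [a b c|a b|a|a|c d a|a|c a b|c d a].
    + pose v := upds v0 0 3 (nth a [:: a; b; c]).
      have : eval v (tadd x0 (tadd x1 x2)) = eval v (tadd (tadd x0 x1) x2).
        by have /(sat_Alls v0 0 3) := H _ TK_addA v0; apply.
      by rewrite !eval_add.
    + pose v := upds v0 0 2 (nth a [:: a; b]).
      have : eval v (tadd x0 x1) = eval v (tadd x1 x0).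
        by have /(sat_Alls v0 0 2) := H _ TK_addC v0; apply.
      by rewrite !eval_add.
    + have h : eval (upd v0 0 a) (tadd tzero x0) = a := H _ TK_add0 v0 a.
      by rewrite -[RHS]h eval_add eval_zero.
    + have : eval (upd v0 0 a) (tadd (tscale (-1)%R x0) x0) =
        eval (upd v0 0 a) tzero := H _ TK_addN v0 a.
      by rewrite eval_add eval_zero.
    + exact: (H _ (TK_scaleA c d) v0 a).
    + exact: (H _ TK_scale1 v0 a).
    + pose v := upds v0 0 2 (nth a [:: a; b]).
      have : vscale c (eval v (tadd x0 x1)) =
          eval v (tadd (tscale c x0) (tscale c x1)).
        by have /(sat_Alls v0 0 2) := H _ (TK_scaleDr c) v0; apply.
      by rewrite !eval_add.
    + have : vscale (c + d)%R a =
        eval (upd v0 0 a) (tadd (tscale c x0) (tscale d x0)) :=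
        H _ (TK_scaleDl c d) v0 a.
      by rewrite eval_add.
  - by move=> c a; apply: (H _ (TK_scaleX c) v0 a).
  - move=> n a; have /sat_Iff h : sat (upd v0 0 a) (fIff (fX n x0) (fExs 1 n (B n))).
      exact: (H _ (TK_Xn n) v0 a).
    rewrite -[mX n a]/(sat (upd v0 0 a) (fX n x0)) h sat_Exs.
    split=> [[f /sat_Xn[f1 f2]]|[x x1 xE]]; first by exists (fun j : 'I_n => f j).
    pose f i := if insub i is Some j then x j else a.
    have fE (j : 'I_n) : f j = x j by rewrite /f valK.
    exists f; apply/sat_Xn; split=> [j|]; first by rewrite fE.
    by rewrite [LHS]xE; apply: eq_bigr => j _; rewrite fE.
  - apply/inf_axesP => // n.
    have /sat_Exs[f /sat_distinct_upds[f1 f2]] := H _ (TK_inf_axes n) v0.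
    by exists f.
  - move=> n; apply/(indepP pr ps pt) => a Xa pa c E i.
    apply: contrapT => ci; have := H _ (TK_indep ci) v0.
    move=> /(sat_Alls v0 0 n.+1)/(_ a) h.
    by apply: h; [exact/sat_distinct_upds|exact/sat_lincomb].
case=> -[A C O N SA S1 Sr Sl] SX Xn pr ps pt ia ind p.
case=> [||||c d||c|c d|c|n||||n|n c i ci] v.
- apply/(sat_Alls v 0 3) => f; rewrite [sat _ _]/=.
  set w := upds v 0 3 f.
  rewrite -[LHS]/(eval w (tadd x0 (tadd x1 x2))).
  by rewrite -[RHS]/(eval w (tadd (tadd x0 x1) x2)) !eval_add A.
- apply/(sat_Alls v 0 2) => f; set w := upds v 0 2 f.
  suff : eval w (tadd x0 x1) = eval w (tadd x1 x0) by [].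
  by rewrite !eval_add C.
- move=> a; set w := upd v 0 a.
  suff : eval w (tadd tzero x0) = eval w x0 by [].
  by rewrite eval_add eval_zero O.
- move=> a; set w := upd v 0 a.
  suff : eval w (tadd (tscale (-1)%R x0) x0) = eval w tzero by [].
  by rewrite eval_add eval_zero; apply: N.
- move=> a; exact: SA.
- move=> a; exact: S1.
- apply/(sat_Alls v 0 2) => f; set w := upds v 0 2 f.
  suff : vscale c (eval w (tadd x0 x1)) =
      eval w (tadd (tscale c x0) (tscale c x1)) by [].
  by rewrite !eval_add; apply: Sr.
- move=> a; set w := upd v 0 a.
  suff : vscale (c + d)%R a = eval w (tadd (tscale c x0) (tscale d x0)) by [].
  by rewrite eval_add; apply: Sl.
- move=> a; exact: SX.
- move=> a.
  suff : sat (upd v 0 a) (fIff (fX n x0) (fExs 1 n (B n))) by [].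
  rewrite sat_Iff sat_Exs.
  rewrite -[sat _ (fX n x0)]/(mX n a) Xn.
  split=> [[x x1 xE]|[f /sat_Xn[f1 f2]]]; last by exists (fun j : 'I_n => f j).
  pose f i := if insub i is Some j then x j else a.
  have fE (j : 'I_n) : f j = x j by rewrite /f valK.
  exists f; apply/sat_Xn; split=> [j|]; first by rewrite fE.
  by rewrite [LHS]xE; apply: eq_bigr => j _; rewrite fE.
- by move=> a /sat_nzX Xa; apply/sat_par/pr.
- apply/(sat_Alls v 0 2) => f.
  move=> /(sat_And _ (fnzX x0) (fnzX x1))[/sat_nzX Xa /sat_nzX Xb] /sat_par ab.
  by apply/sat_par/ps.
- apply/(sat_Alls v 0 3) => f.
  move=> /(sat_And _ (fnzX x0) (fAnd (fnzX x1) (fnzX x2)))[/sat_nzX Xa].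
  move=> /sat_And[/sat_nzX Xb /sat_nzX Xc].
  by move=> /sat_par ab /sat_par bc; apply/sat_par; apply: pt ab bc.
- have [f f1 f2] := (inf_axesP pr ps pt).1 ia n.
  by apply/sat_Exs; exists f; apply/sat_distinct_upds.
- apply/(sat_Alls v 0 n.+1) => f /sat_distinct_upds[f1 f2] /sat_lincomb E.
  exact: ci ((indepP pr ps pt n).1 (ind n) f f1 f2 c E i).
Qed.

End Adequacy.

End TK.

(* Main.v *)
Require Import Defs.
From HB Require Import structures.
From mathcomp Require Import all_boot all_order all_algebra.
From mathcomp Require Import boolp classical_sets functions cardinality filter.

(** A formula of some model [M] of T_K that has no Morley rank is the root of a
binary tree of consistent formulas, in which children imply their parent and
the two children of a node are incompatible ([unranked_tree]).  The theorem
holds because no model of T_K carries such a tree ([TK_no_unranked]), and this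
is shown by counting types.

The countably many formulas of a tree have their scalars in a countable
subfield [k] of K and their parameters in a countable set [A].  In an
ultrapower [N] of [M] along a free ultrafilter on nat, the theorem of Los lets
each of the continuum many branches of the tree be realised by a tuple, and a
formula over [k] with parameters in [A] separates any two of these tuples.  On
the other hand only countably many types over [A], for formulas over [k], are
realised by tuples of [N].

This last fact comes from the geometry of T_K.  The span of X is the direct sum
of the axes, so a vector of this span has a well defined number of nonzero
components, and X^n consists of the vectors with at most [n] of them
([separated_size]).  Hence a k-linear bijection between subspaces preserves all
the predicates X^n as soon as it matches axes with axes and its domain and
range contain the components of their elements ([matching],
[matching_Xsum]).  Such a matching extends to one more vector [a]: when [a]
lies in an axis that is already matched, the image is a new vector of the
corresponding axis; when [a] lies in an unmatched axis, it is a vector of an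
unmatched axis; and outside the span of X modulo the domain, it is a vector
outside the span of X modulo the range ([good_extend]).  The three kinds of
target exist whenever the range is countable, since in [N] no axis is
countable (here K has to be infinite), no countable set contains a nonzero vector
of every axis, and no countable set represents all the classes modulo the span of
X ([ultrapower_rich]).  So tuples related by a matching with countable range
satisfy the same formulas over [k] ([back_and_forth]).

The targets can also be chosen in one fixed countable set [E] containing [A],
built as the union of a chain of countable subspaces each of which contains the
targets for the previous one ([countable_rich_family]).  Then every tuple of
[N] has the same type over [A] as a tuple of [E], and there are only countably
many of the latter. *)

Set Implicit Arguments.
Unset Strict Implicit.
Unset Printing Implicit Defensive.

Import GRing.Theory.

Local Open Scope classical_set_scope.

(** * Morley rank and binary trees *)

Section Rank.
Variables (L : language) (M : structure L) (n : nat).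
Implicit Types p q : pformula M.

Definition unranked p : Prop := forall o, MR_ge n o p.

(** The rank is found by descending along the notation of a bound that fails:
at a supremum some member of the family already fails, and at a successor the
predecessor is the rank unless it fails too. *)
Lemma MR_eq_exists p : consistent n p -> ~ unranked p -> exists o, MR_eq n p o.
Proof.
move=> cp /existsNP[o]; elim: o => [|o IH|A f IH] //= H.
  have [Ho|/IH//] := EM (MR_ge n o p).
  by exists o.
have /existsNP[x /IH//] : ~ forall x, MR_ge n (f x) p by move=> Hx; apply: H.
Qed.

Lemma MR_ge_consistent o p : MR_ge n o p -> consistent n p.
Proof.
elim: o p => [|o IH|A f _] p //=; last by case.
by case=> q [qp _ /(_ 0) /IH[a qa]]; exists a; apply: (qp 0).
Qed.

(** A bound failed by a ranked formula can be chosen for every formula with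
parameters in [M]; a formula whose rank reaches the supremum of these bounds is
then unranked.  Rank at least the successor of this supremum gives infinitely
many disjoint unranked formulas, and two of them are kept. *)
Lemma unranked_split p : unranked p -> exists q : bool -> pformula M,
  [/\ forall b, unranked (q b),
      forall b (a : 'I_n -> M), psat (q b) a -> psat p a &
      forall a : 'I_n -> M, ~ (psat (q false) a /\ psat (q true) a)].
Proof.
move=> up.
have /choice[h Hh] q : exists o, ~ unranked q -> ~ MR_ge n o q.
  have [uq|/existsNP[o Ho]] := EM (unranked q); first by exists oZero.
  by exists o.
have unrk q : MR_ge n (oSup h) q -> unranked q.
  by case=> _ Hq; apply: contrapT => /Hh; apply; exact: Hq.
have [q [qp dq /(_ _)/unrk uq]] := up (oSucc (oSup h)).
exists (fun b => q (nat_of_bool b)); split=> // [b a|a]; first exact: qp.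
by apply: dq.
Qed.

(** Iterating the splitting places the formula at the end of the path [w] below
[p]. *)
Lemma unranked_tree p : unranked p -> exists T : seq bool -> pformula M,
  [/\ forall w, consistent n (T w),
      forall w b (a : 'I_n -> M), psat (T (rcons w b)) a -> psat (T w) a &
      forall w (a : 'I_n -> M),
        ~ (psat (T (rcons w false)) a /\ psat (T (rcons w true)) a)].
Proof.
move=> up.
have /choice[h Hh] (q : {q | unranked q}) :
    exists r : bool -> {q | unranked q},
  (forall b (a : 'I_n -> M), psat (sval (r b)) a -> psat (sval q) a) /\
  (forall a : 'I_n -> M, ~ (psat (sval (r false)) a /\ psat (sval (r true)) a)).
  have [r [ur rq dr]] := unranked_split (svalP q).
  by exists (fun b => exist _ (r b) (ur b)).
pose T w := foldl h (exist _ p up) w.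
exists (sval \o T); split=> [w|w b a|w a] /=.
- exact: MR_ge_consistent (svalP (T w) oZero).
- by rewrite /T foldl_rcons; exact: (Hh _).1.
- by rewrite /T !foldl_rcons; exact: (Hh _).2.
Qed.

End Rank.

(** * Ultrapowers along a free ultrafilter on nat *)

Section Ultrapower.
Variables (L : language) (M : structure L).
Variables (U : set_system nat) (UU : UltraFilter U).
Hypothesis free_U : \oo `<=` U.

#[local] Instance ultra_proper_U : ProperFilter U := @ultra_proper _ U UU.

Lemma ultra_false : ~ U (fun=> False).
Proof. exact: (@filter_not_empty _ U). Qed.

Lemma ultra_not (P : nat -> Prop) : U [set k | ~ P k] <-> ~ U [set k | P k].
Proof.
split=> [H1 H2|H].
  by apply: ultra_false; apply: filterS (filterI H1 H2) => k [].
by case: (in_ultra_setVsetC [set k | P k] UU).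
Qed.

Lemma ultra_imp (P Q : nat -> Prop) :
  U [set k | P k -> Q k] <-> (U [set k | P k] -> U [set k | Q k]).
Proof.
split=> [H1 H2|H].
  by apply: filterS (filterI H1 H2) => k [] /= h /h.
have [/H UQ|/ultra_not UP] := EM (U [set k | P k]).
  by apply: filterS UQ => k /=.
by apply: filterS UP => k /=.
Qed.

Lemma ultra_forall_ord m (P : 'I_m -> nat -> Prop) :
  (forall i, U [set k | P i k]) -> U [set k | forall i, P i k].
Proof.
elim: m P => [|m IH] P H; first by apply: filterS filterT => k _ [].
apply: filterS (filterI (H ord0) (IH _ (fun i => H (lift ord0 i)))) => k [] /=.
by move=> P0 PS i; case: (unliftP ord0 i) => [j|] ->.
Qed.

Lemma ultra_ge j : U [set k | j <= k].
Proof. by apply: free_U; exists j. Qed.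

Definition ultra_eq (f g : nat -> M) : Prop := U [set k | f k = g k].

Lemma ultra_eq_refl f : ultra_eq f f.
Proof. by apply: filterS filterT. Qed.

Lemma ultra_eq_sym f g : ultra_eq f g -> ultra_eq g f.
Proof. by apply: filterS => k /esym. Qed.

Lemma ultra_eq_trans f g h : ultra_eq f g -> ultra_eq g h -> ultra_eq f h.
Proof. by move=> H1 H2; apply: filterS (filterI H1 H2) => k [/= -> ->]. Qed.

(** Germs are equivalence classes taken as sets of sequences, so that equality
of germs is Leibniz equality. *)
Definition ultra_carrier : Type :=
  {A : set (nat -> M) | exists f, A = ultra_eq f}.

Definition germ (f : nat -> M) : ultra_carrier :=
  exist _ (ultra_eq f) (ex_intro _ f erefl).

Lemma germ_eq f g : germ f = germ g <-> ultra_eq f g.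
Proof.
split=> [[E]|fg]; first by rewrite E; exact: ultra_eq_refl.
apply: eq_exist; apply/seteqP; split=> h; apply: ultra_eq_trans => //.
exact: ultra_eq_sym.
Qed.

Lemma germ_surj a : exists f, a = germ f.
Proof. by case: a => A HA; case: (HA) => f E; exists f; exact: eq_exist. Qed.

Definition germ_rep (a : ultra_carrier) : nat -> M := sval (cid (germ_surj a)).

Lemma germ_repK a : germ (germ_rep a) = a.
Proof. by rewrite /germ_rep; case: cid. Qed.

Definition ultrapower : structure L := {|
  carrier := ultra_carrier;
  finterp := fun f xs => germ (fun k => finterp (fun i => germ_rep (xs i) k));
  rinterp := fun r xs => U [set k | rinterp (fun i => germ_rep (xs i) k)] |}.

Lemma germ_rep_germ f : U [set k | germ_rep (germ f) k = f k].
Proof. by apply/germ_eq; exact: germ_repK. Qed.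

Lemma finterp_germ (f : Defs.fsym L) (xs : 'I_(farity f) -> nat -> M) :
  finterp (s := ultrapower) (fun i => germ (xs i)) =
  germ (fun k => finterp (fun i => xs i k)).
Proof.
apply/germ_eq; apply: filterS (ultra_forall_ord (fun i => germ_rep_germ (xs i))).
by move=> k /= H; congr finterp; apply/funext.
Qed.

Lemma rinterp_germ (r : Defs.rsym L) (xs : 'I_(rarity r) -> nat -> M) :
  rinterp (s := ultrapower) (fun i => germ (xs i)) <->
  U [set k | rinterp (fun i => xs i k)].
Proof.
have H := ultra_forall_ord (fun i => germ_rep_germ (xs i)).
split=> H1; apply: filterS (filterI H H1) => k [/= /funext E].
  by rewrite E.
by rewrite -E.
Qed.

Lemma eval_germ (v : nat -> nat -> M) t :
  eval (M := ultrapower) (fun x => germ (v x)) t =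
  germ (fun k => eval (fun x => v x k) t).
Proof.
elim: t => [x|f ts IH]; first by [].
rewrite -[RHS](finterp_germ (fun i k => eval (fun x => v x k) (ts i))).
by rewrite -(funext IH).
Qed.

Theorem Los (v : nat -> nat -> M) p :
  sat (M := ultrapower) (fun x => germ (v x)) p <->
  U [set k | sat (fun x => v x k) p].
Proof.
elim: p v => [|t u|r ts|p IHp q IHq|y p IH] v.
- split=> //= H; apply: ultra_false; exact: H.
- by rewrite /= !eval_germ germ_eq.
- rewrite -(rinterp_germ (fun i k => eval (fun x => v x k) (ts i))).
  by rewrite -(funext (fun i => eval_germ v (ts i))).
- by rewrite /= (ultra_imp (fun k => _)) IHp IHq.
- have updE w k : (fun x => (if x == y then w else v x) k) =
      upd (fun x => v x k) y (w k).
    by apply/funext => x; rewrite /upd; case: ifP.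
  have updG w : upd (M := ultrapower) (fun x => germ (v x)) y (germ w) =
      fun x => germ (if x == y then w else v x).
    by apply/funext => x; rewrite /upd; case: ifP.
  split=> [H|H a]; last first.
    rewrite -(germ_repK a) updG; apply/IH.
    by under eq_fun do rewrite updE; apply: filterS H => k /=.
  apply: contrapT => /ultra_not NH.
  have /choice[w Hw] k : exists a,
      ~ (forall b, sat (upd (fun x => v x k) y b) p) ->
      ~ sat (upd (fun x => v x k) y a) p.
    have [[a Ha]|N] := EM (exists a, ~ sat (upd (fun x => v x k) y a) p).
      by exists a.
    by exists (v 0 k) => Na _; apply: Na => b; apply: contrapT => Nb; apply: N; exists b.
  have := H (germ w); rewrite updG => /IH.
  under eq_fun do rewrite updE.
  by apply/ultra_not; apply: filterS NH => k /= /Hw.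
Qed.

Lemma models_ultrapower T : models M T -> models ultrapower T.
Proof.
move=> HM p Tp v.
have -> : v = (fun x => germ (germ_rep (v x))).
  by apply/funext => x; rewrite germ_repK.
by apply/Los; apply: filterS filterT => k _; exact: HM.
Qed.

(** Countable saturation of ultrapowers in the form in which it is used: a single
sequence [b] meets all the conditions [Q j] on sets of the ultrafilter, because
[b k] is only asked to meet the first [k] of them and the ultrafilter contains
the final segments. *)
Lemma ultra_diagonal (T : Type) (Q : nat -> nat -> T -> Prop) :
  U [set k | exists b, forall j, j <= k -> Q j k b] ->
  exists b, forall j, U [set k | Q j k (b k)].
Proof.
move=> H.
have [m] : inhabited T.
  apply: contrapT => N; apply: ultra_false.
  by apply: filterS H => k [b _]; apply: N; exists.
have /choice[b Hb] k : exists b,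
    (exists b, forall j, j <= k -> Q j k b) -> forall j, j <= k -> Q j k b.
  have [[b ?]|N] := EM (exists b, forall j, j <= k -> Q j k b); first by exists b.
  by exists m => /N.
exists b => j; apply: filterS (filterI H (ultra_ge j)) => k [/= /Hb h jk].
exact: h.
Qed.

End Ultrapower.

Lemma free_ultrafilter : exists2 U : set_system nat, UltraFilter U & \oo `<=` U.
Proof.
have [U [UU sU]] := ultraFilterLemma (eventually_filter : ProperFilter \oo).
by exists U.
Qed.

(** * Sums of elements of independent axes *)

Local Open Scope ring_scope.

Section PairwiseComplements.
Variables (T : eqType) (r : rel T).

Lemma pairwisePn s : ~~ pairwise r s ->
  exists x y t, perm_eq s (x :: y :: t) /\ ~~ r x y.
Proof.
elim: s => //= x s IH; rewrite negb_and => /orP[/allPn[y sy Nxy]|/IH].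
  by exists x, y, (rem y s); rewrite perm_cons perm_to_rem.
case=> [y [z [t [st Nyz]]]]; exists y, z, (x :: t); split=> //.
rewrite -[perm_eq _ _]/(perm_eq _ ([:: y; z] ++ [:: x] ++ t)).
by rewrite perm_sym perm_catCA perm_sym /= perm_cons.
Qed.

Lemma pairwise_rem x s : symmetric r -> pairwise r s -> x \in s ->
  all (r x) (rem x s).
Proof.
move=> sym_r; elim: s => //= y s IH /andP[ys /IH{}IH].
rewrite inE [x == y]eq_sym; case: eqP => [<- //|_ /= xs].
by rewrite IH // andbT sym_r (allP ys).
Qed.

End PairwiseComplements.

Section Axes.
Variables (K : fieldType) (V : lmodType K) (X : set V).

(** What T_K says of X inside a vector space.  Reflexivity and symmetry of
parallelism follow from closure under scalars and commutativity.  Linear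
independence is stated with all coefficients equal to 1, since X is closed under
multiplication by scalars. *)
Record axes_system : Prop := {
  axes0 : X 0;
  axesZ : forall c a, X a -> X (c *: a);
  axes_trans : forall a b c, X a -> a <> 0 -> X b -> b <> 0 -> X c -> c <> 0 ->
    X (a + b) -> X (b + c) -> X (a + c);
  axes_indep : forall s, s != [::] -> (forall x, x \in s -> X x /\ x <> 0) ->
    pairwise (fun x y => ~~ `[< X (x + y) >]) s -> \sum_(x <- s) x <> 0 }.

Hypothesis HX : axes_system.

Definition nz a := X a /\ a <> 0.
Definition par a b := `[< X (a + b) >].
Definition separated := pairwise (fun x y => ~~ par x y).

Lemma parP a b : reflect (X (a + b)) (par a b).
Proof. exact: asboolP. Qed.

Lemma par_sym : symmetric par.
Proof. by move=> a b; rewrite /par addrC. Qed.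

Lemma par_refl a : X a -> par a a.
Proof. by move=> Xa; apply/parP; rewrite -mulr2n -scaler_nat; apply: axesZ. Qed.

Lemma par_trans a b c : nz a -> nz b -> nz c -> par a b -> par b c -> par a c.
Proof.
move=> [Xa a0] [Xb b0] [Xc c0] /parP ab /parP bc; apply/parP.
exact: (axes_trans HX Xa a0 Xb b0 Xc c0).
Qed.

Lemma nzZ c a : c != 0 -> nz a -> nz (c *: a).
Proof.
move=> c0 [Xa a0]; split; first exact: axesZ.
by move/eqP; rewrite scaler_eq0 (negPf c0) => /eqP.
Qed.

Lemma parZ c a : X a -> par a (c *: a).
Proof.
by move=> Xa; apply/parP; rewrite -{1}[a]scale1r -scalerDl; apply: axesZ.
Qed.

(** Axes are closed under addition; when 2 is not 0 this uses that a is parallel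
to 2a, and when 2 = 0 the sum a + (a + b) is b. *)
Lemma par_addr a b : nz a -> nz b -> par a b -> par a (a + b).
Proof.
move=> na nb ab; apply/parP; rewrite addrA -mulr2n -scaler_nat.
have [->|d0] := eqVneq (2%:R : K) 0; first by rewrite scale0r add0r; case: nb.
apply/parP; apply: par_trans (na) (nb) _ ab; first exact: nzZ.
by rewrite par_sym; apply: parZ; case: na.
Qed.

Lemma separated_rem s x y :
  separated s -> x \in s -> y \in rem x s -> ~~ par x y.
Proof.
move=> seps xs; suff /allP : all (fun y => ~~ par x y) (rem x s) by apply.
by apply: (pairwise_rem (r := fun x y => ~~ par x y)) => // u v; rewrite par_sym.
Qed.

Section Normalize.
Variables (Z : zmodType) (f : Z -> V) (S : set Z).
Hypothesis S_merge : forall z w, S z -> S w -> par (f z) (f w) ->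
  z + w = 0 \/ S (z + w).

(** Parallel terms of a sum can be merged until no two are parallel.  The sum
lives in a group [Z] above [V] because it is also needed for sums of pairs of
vectors whose first components are compared. *)
Lemma normalize s : (forall z, z \in s -> S z) -> exists t,
  [/\ forall z, z \in t -> S z, separated (map f t) &
      \sum_(z <- t) z = \sum_(z <- s) z].
Proof.
have [m] := ubnP (size s); elim: m s => // m IH s; rewrite ltnS => sm sS.
have [sep|] := boolP (separated (map f s)); first by exists s.
rewrite /separated pairwise_map => /pairwisePn[z [w [t [st /negPn /= zw]]]].
have sE : \sum_(z <- s) z = z + w + \sum_(z <- t) z.
  by rewrite (perm_big _ st) /= !big_cons addrA.
have tS y : y \in z :: w :: t -> S y by rewrite -(perm_mem st); exact: sS.
have tS' y : y \in t -> S y by move=> ty; apply: tS; rewrite !inE ty !orbT.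
have := perm_size st; rewrite /= => szs; rewrite szs in sm.
have Sw : S w by apply: tS; rewrite !inE eqxx orbT.
have [zw0|Szw] := S_merge (tS z (mem_head _ _)) Sw zw.
  by have [u Hu] := IH t (ltnW sm) tS'; exists u; rewrite sE zw0 add0r.
have zwtS y : y \in z + w :: t -> S y by rewrite inE => /predU1P[->|/tS'].
have [u] := IH (z + w :: t) sm zwtS; rewrite big_cons -sE => Hu.
by exists u.
Qed.

End Normalize.

(** Merging the terms of the sum keeps them off the axis of [x], after which
linear independence of distinct axes applies. *)
Lemma sum_npar_neq0 x s : nz x -> (forall y, y \in s -> nz y /\ ~~ par x y) ->
  x + \sum_(y <- s) y <> 0.
Proof.
move=> nx sS.
have [||t [tS sept <-]] := @normalize V id [set y | nz y /\ ~~ par x y] _ s.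
- move=> y z [ny xy] [nz' xz] yz.
  have [->|/eqP yz0] := eqVneq (y + z) 0; [by left|right].
  have nyz : nz (y + z) by split=> //; exact/parP.
  split=> //; apply: contra xy => xyz; apply: par_trans (nx) (nyz) (ny) xyz _.
  by rewrite par_sym; apply: par_addr.
- exact: sS.
rewrite map_id in sept.
have := axes_indep HX (s := x :: t); rewrite big_cons; apply=> //=.
  by move=> y; rewrite inE => /predU1P[->|/tS[]].
apply/andP; split=> //; apply/allP => y /tS[]; exact.
Qed.

(** A sum of [n] nonzero vectors of distinct axes has exactly [n] components, so
it is not a sum of fewer elements of X.  If every [x] in [s] were parallel to a
term of [t], an injection from [s] to [t] would result; and an [x] parallel to no
term of [t] cannot cancel against the other terms. *)
Lemma separated_size s t : (forall x, x \in s -> nz x) -> separated s ->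
  (forall y, y \in t -> X y) -> \sum_(x <- s) x = \sum_(y <- t) y ->
  (size s <= size t)%N.
Proof.
move=> ns seps Xt E.
have uniqs : uniq s.
  rewrite uniq_pairwise; apply: (sub_in_pairwise (P := [in s])) seps; last exact/allP.
  by move=> x y /ns[Xx _] _; apply: contra => /eqP <-; exact: par_refl.
have [[x [xs Hx]]|H] := EM (exists x, x \in s /\
    forall y, y \in t -> y <> 0 -> ~~ par x y).
  pose s' := rem x s ++ [seq - y | y <- t & y != 0].
  have t0 : \sum_(y <- t | y != 0) y = \sum_(y <- t) y.
    rewrite [RHS](bigID (fun y => y != 0)) /= [X in _ + X]big1 ?addr0 //.
    by move=> y /negPn/eqP.
  have [] := @sum_npar_neq0 x s' (ns _ xs); last first.
    rewrite big_cat /= big_map big_filter sumrN t0 addrA -E.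
    by rewrite (perm_big _ (perm_to_rem xs)) /= big_cons subrr.
  move=> y; rewrite mem_cat => /orP[ys|/mapP[z]].
    split; first exact: ns (mem_rem ys).
    exact: separated_rem seps xs ys.
  rewrite mem_filter => /andP[/eqP z0 zt] ->; have nz' : nz z by split=> //; exact: Xt.
  have nNz : nz (- z) by rewrite -scaleN1r; apply: nzZ; rewrite ?oppr_eq0 ?oner_eq0.
  split=> //; apply: contra (Hx z zt z0) => xz.
  apply: par_trans (ns _ xs) nNz (nz') xz _.
  by rewrite par_sym -scaleN1r; apply: parZ; case: nz'.
have /choice[g Hg] x : exists y, x \in s -> [/\ y \in t, y <> 0 & par x y].
  have [xs|] := boolP (x \in s); last by exists 0.
  apply: contrapT => N; apply: H; exists x; split=> // y ty y0.
  by apply/negP => xy; apply: N; exists y.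
rewrite -(size_map g); apply: uniq_leq_size.
  rewrite map_inj_in_uniq // => x x' xs xs' gE.
  have [gt g0 xg] := Hg x xs; have [_ _] := Hg x' xs'; rewrite -gE => xg'.
  have xx' : par x x'.
    apply: par_trans (ns x xs) _ (ns _ xs') xg _; last by rewrite par_sym.
    by split=> //; exact: Xt.
  apply/eqP/negPn/negP => nxx'.
  have x'r : x' \in rem x s by rewrite mem_rem_uniq // !inE eq_sym nxx'.
  by have := separated_rem seps xs x'r; rewrite xx'.
by move=> y /mapP[x xs ->]; case: (Hg x xs).
Qed.

Definition Xsum n a := exists s : seq V,
  [/\ size s = n, forall x, x \in s -> X x & a = \sum_(x <- s) x].

Definition Xspan a := exists n, Xsum n a.

Lemma Xsum_pad m n a : (m <= n)%N -> Xsum m a -> Xsum n a.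
Proof.
move=> mn [s [sz Xs ->]]; exists (nseq (n - m) 0 ++ s); split.
- by rewrite size_cat size_nseq sz subnK.
- by move=> x; rewrite mem_cat mem_nseq => /orP[/andP[_ /eqP->]|/Xs//]; exact: axes0.
- by rewrite big_cat /= [X in X + _]big1_seq ?add0r // => x /nseqP[].
Qed.

Lemma XsumD m n a b : Xsum m a -> Xsum n b -> Xsum (m + n) (a + b).
Proof.
move=> [s [<- Xs ->]] [t [<- Xt ->]]; exists (s ++ t).
split; [by rewrite size_cat| |by rewrite big_cat].
by move=> x; rewrite mem_cat => /orP[/Xs|/Xt].
Qed.

Lemma XsumZ n c a : Xsum n a -> Xsum n (c *: a).
Proof.
move=> [s [<- Xs ->]]; exists [seq c *: x | x <- s].
split; [by rewrite size_map| |by rewrite big_map scaler_sumr].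
by move=> _ /mapP[x /Xs Xx ->]; apply: axesZ.
Qed.

Lemma Xsum1 a : X a -> Xsum 1 a.
Proof.
by move=> Xa; exists [:: a]; rewrite big_seq1; split=> // x; rewrite inE => /eqP->.
Qed.

Lemma XspanD a b : Xspan a -> Xspan b -> Xspan (a + b).
Proof. by move=> [m Ha] [n Hb]; exists (m + n)%N; exact: XsumD. Qed.

Lemma XspanZ c a : Xspan a -> Xspan (c *: a).
Proof. by move=> [m Ha]; exists m; exact: XsumZ. Qed.

Lemma Xspan1 a : X a -> Xspan a.
Proof. by move=> Xa; exists 1%N; exact: Xsum1. Qed.

End Axes.

(** * Partial isomorphisms as matchings of axes *)

Record subfield (K : fieldType) (k : set K) : Prop := {
  sub0 : k 0; sub1 : k 1;
  subD : forall a b, k a -> k b -> k (a + b);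
  subM : forall a b, k a -> k b -> k (a * b);
  subN : forall a, k a -> k (- a);
  subV : forall a, k a -> k a^-1 }.

Section BackAndForth.
Variables (K : fieldType) (V : lmodType K) (X : set V).
Hypothesis HX : axes_system X.
Variables (k : set K) (kk : subfield k).

Record subspace (W : lmodType K) (C : set W) : Prop := {
  sp0 : C 0;
  spD : forall a b, C a -> C b -> C (a + b);
  spZ : forall c a, k c -> C a -> C (c *: a) }.

Definition adjoin (W : lmodType K) (C : set W) (b : W) : set W :=
  [set a | exists c l, [/\ C c, k l & a = c + l *: b]].

Lemma adjoin_sub (W : lmodType K) (C : set W) b : C `<=` adjoin C b.
Proof. by move=> c Cc; exists c, 0; rewrite scale0r addr0; split=> //; exact: sub0. Qed.

Lemma adjoin_mem (W : lmodType K) (C : set W) b : C 0 -> adjoin C b b.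
Proof. by move=> C0; exists 0, 1; rewrite scale1r add0r; split=> //; exact: sub1. Qed.

Lemma adjoin_subspace (W : lmodType K) (C : set W) b :
  subspace C -> subspace (adjoin C b).
Proof.
move=> HC; split.
- by apply: adjoin_sub; exact: sp0.
- move=> _ _ [c [l [Cc kl ->]]] [d [m [Cd km ->]]].
  by exists (c + d), (l + m); rewrite scalerDl addrACA; split=> //; [exact: spD|exact: subD].
- move=> m _ km [c [l [Cc kl ->]]]; exists (m *: c), (m * l).
  by rewrite scalerDr scalerA; split=> //; [exact: spZ|exact: subM].
Qed.

(** This is where the scalars have to form a field: the coefficient [l] of [b] is
inverted inside [k]. *)
Lemma adjoin_rebase (W : lmodType K) (C : set W) b c l :
  subspace C -> C c -> k l -> l != 0 -> C (c + l *: b) -> C b.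
Proof.
move=> HC Cc kl l0 H; have N1 : k (-1) by apply: subN => //; exact: sub1.
have : C (l^-1 *: ((c + l *: b) + (-1) *: c)).
  by apply: spZ => //; [exact: subV|apply: spD => //; exact: spZ].
by rewrite scaleN1r addrAC subrr add0r scalerA mulVf // scale1r.
Qed.

(** A partial injection between sets of axes, given by the pairs of nonzero
vectors that lie on corresponding axes. *)
Record axis_matching (s : set (V * V)) : Prop := {
  m_nz : forall a b, s (a, b) -> nz X a /\ nz X b;
  m_par : forall a b c d, s (a, b) -> s (c, d) -> par X a c = par X b d;
  m_sat : forall a b c d, s (a, b) -> nz X c -> nz X d ->
    par X a c -> par X b d -> s (c, d) }.

Definition represented (g s : set (V * V)) : Prop :=
  forall a b, s (a, b) -> exists c d, [/\ g (c, d), s (c, d) & par X a c].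

(** The graph [g] of a k-linear bijection between subspaces, compatible with the
matching [s] of axes.  Keeping [s] apart from [g] spares the description of all
the elements of X in an extended domain; [m_rep] says that [s] matches only axes
that meet the domain, so that the smallness of the range of [g] also bounds the
set of matched axes.  [m_span] says that the domain and the range contain the
components of their elements. *)
Record matching (g s : set (V * V)) : Prop := {
  m_sub : subspace g;
  m_inj : forall a b, g (a, b) -> (a = 0 <-> b = 0);
  m_axis : axis_matching s;
  m_rep : represented g s;
  m_span : forall a b, g (a, b) -> Xspan X a \/ Xspan X b -> exists t,
    (forall z, z \in t -> g z /\ s z) /\ (a, b) = \sum_(z <- t) z }.

Definition dom (g : set (V * V)) : set V := [set a | exists b, g (a, b)].
Definition ran (g : set (V * V)) : set V := [set b | exists a, g (a, b)].
Definition swap (g : set (V * V)) : set (V * V) := [set z | g (z.2, z.1)].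

Lemma sum_pair (t : seq (V * V)) :
  \sum_(z <- t) z = (\sum_(z <- t) z.1, \sum_(z <- t) z.2).
Proof. by elim: t => [|z t IH]; rewrite ?big_nil // !big_cons IH. Qed.

Lemma matching_swap g s : matching g s -> matching (swap g) (swap s).
Proof.
case=> [[g0 gD gZ] inj [nzs pars sats] rep span].
have parsw a b c d : s (a, b) -> s (c, d) -> par X b d = par X a c.
  by move=> ab cd; rewrite (pars _ _ _ _ ab cd).
split=> /=.
- split=> //= [[a b] [c d]|c [a b]]; [exact: gD|exact: gZ].
- by move=> a b /inj[? ?].
- split=> /=.
  + by move=> a b /nzs[].
  + by move=> a b c d ab cd; exact: parsw ab cd.
  + by move=> a b c d ab nc nd ac bd; exact: sats ab nd nc bd ac.
- move=> a b ab; have [c [d [gcd scd bc]]] := rep _ _ ab.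
  by exists d, c; split=> //; rewrite (parsw _ _ _ _ ab scd).
- move=> a b ab W; have [t [Ht E]] := span _ _ ab ((or_comm _ _).1 W).
  exists [seq (z.2, z.1) | z <- t]; split.
    by move=> _ /mapP[[c d] /Ht H ->].
  by move: E; rewrite sum_pair => -[-> ->]; rewrite sum_pair !big_map.
Qed.

(** In a decomposition of the pair (a, b) without parallel terms, the number of
terms is the least [n] for which [a] is in X^n, and the second components show
that [b] is in X^n too. *)
Lemma matching_Xsum g s n a b : matching g s -> g (a, b) ->
  Xsum X n a -> Xsum X n b.
Proof.
move=> H gab Ha; have [t [gst E]] := m_span H gab (or_introl (ex_intro _ n Ha)).
have [||u [gsu sepu Eu]] := @normalize K V X (V * V)%type fst (g `&` s) _ t.
- move=> [c d] [c' d'] [gcd scd] [gcd' scd'] /= cc'.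
  have gD := spD (m_sub H) gcd gcd'.
  have [nc nd] := m_nz (m_axis H) scd; have [nc' nd'] := m_nz (m_axis H) scd'.
  have dd' : par X d d' by rewrite -(m_par (m_axis H) scd scd').
  have [c0|/eqP c0] := eqVneq (c + c') 0.
    left; rewrite -[RHS]/(0, 0); congr pair => //.
    exact/(m_inj H gD).
  right; split=> //; apply: (m_sat (m_axis H) scd).
  + by split=> //; exact/parP.
  + by split; [exact/parP|move=> /(m_inj H gD)].
  + exact: par_addr.
  + exact: par_addr.
- exact: gst.
rewrite -Eu sum_pair in E; case: E => Ea Eb.
case: Ha => v [szv Xv av].
have le_un : (size u <= n)%N.
  rewrite -szv -(size_map fst u); apply: (separated_size HX) => //.
    by move=> _ /mapP[[c d] /gsu[_ /(m_nz (m_axis H))[]] ? _ ->].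
  by rewrite big_map -Ea.
apply: (Xsum_pad HX le_un); exists (map snd u); rewrite size_map big_map -Eb.
split=> // _ /mapP[[c d] /gsu[_ /(m_nz (m_axis H))[_ [Xd _]]] ->]; exact: Xd.
Qed.

Lemma represented_adjoin g s z : matching g s -> represented (adjoin g z) s.
Proof.
move=> H a b /(m_rep H)[c [d [gcd scd ac]]]; exists c, d; split=> //.
exact: adjoin_sub.
Qed.

(** When [a] and [b] lie on matched axes, the multiples of (a, b) are the only new
components that occur in the extended domain and range; when both are outside
the span of X modulo the old domain and range, no new vector enters this
span. *)
Lemma matching_extend g s s' a b : matching g s -> ~ dom g a -> ~ ran g b ->
  s `<=` s' -> axis_matching s' -> represented (adjoin g (a, b)) s' ->
  (s' (a, b) \/ (forall c, dom g c -> ~ Xspan X (c + a)) /\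
               (forall d, ran g d -> ~ Xspan X (d + b))) ->
  matching (adjoin g (a, b)) s'.
Proof.
move=> [[g0 gD gZ] inj _ _ span] Na Nb ss' Hs' rep alt.
have [nzs _ sats] := Hs'.
have sub := @adjoin_sub _ g (a, b).
have dsub : subspace (dom g).
  split; first by exists 0.
    by move=> c c' [d cd] [d' cd']; exists (d + d'); exact: gD cd cd'.
  by move=> l c kl [d cd]; exists (l *: d); exact: gZ kl cd.
have rsub : subspace (ran g).
  split; first by exists 0.
    by move=> c c' [d cd] [d' cd']; exists (d + d'); exact: gD cd cd'.
  by move=> l c kl [d cd]; exists (l *: d); exact: gZ kl cd.
split=> //.
- by apply: adjoin_subspace; split.
- move=> _ _ [[c d] [l [gcd kl [-> ->]]]].
  have [->|l0] := eqVneq l 0; first by rewrite !scale0r !addr0; exact: inj.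
  have dc : dom g c by exists d.
  have rd : ran g d by exists c.
  split=> E; exfalso.
    by apply/Na/(adjoin_rebase dsub dc kl l0); rewrite E; exact: sp0.
  by apply/Nb/(adjoin_rebase rsub rd kl l0); rewrite E; exact: sp0.
move=> _ _ [[c d] [l [gcd kl [-> ->]]]] W.
have lift : Xspan X c \/ Xspan X d -> exists t,
    (forall z, z \in t -> adjoin g (a, b) z /\ s' z) /\ (c, d) = \sum_(z <- t) z.
  move=> /(span _ _ gcd)[t [gst Et]]; exists t; split=> // z /gst[? ?].
  by split; [exact: sub|exact: ss'].
have [l0|l0] := eqVneq l 0.
  by move: W; rewrite l0 !scale0r !addr0; exact: lift.
case: alt => [sab|[Wa Wb]]; last first.
  exfalso; case: W => /(XspanZ HX l^-1); rewrite scalerDr scalerA mulVf // scale1r.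
    by apply: Wa; apply: spZ => //; [exact: subV|exists d].
  by apply: Wb; apply: spZ => //; [exact: subV|exists c].
have [na nb] := nzs _ _ sab.
have slab : s' (l *: a, l *: b).
  apply: (sats _ _ _ _ sab); first exact: nzZ.
  - exact: nzZ.
  - by apply: parZ => //; case: na.
  - by apply: parZ => //; case: nb.
have W' : Xspan X c \/ Xspan X d.
  case: W => W; [left|right].
    rewrite -[c](addrK (l *: a)) -scaleNr; apply: XspanD => //.
    by apply: Xspan1; apply: axesZ => //; case: na.
  rewrite -[d](addrK (l *: b)) -scaleNr; apply: XspanD => //.
  by apply: Xspan1; apply: axesZ => //; case: nb.
have [t [gst Et]] := lift W'.
exists ((l *: a, l *: b) :: t); split.
  move=> z; rewrite inE => /predU1P[->|/gst//]; split=> //.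
  by exists 0, l; rewrite add0r.
by rewrite big_cons -Et; congr pair; rewrite /= addrC.
Qed.

(** Subsets of [V] that are small enough to leave room for the next target of an
extension step, together with room for iterating this. *)
Record rich (F : set (set V)) : Prop := {
  rich_axis : forall C x, F C -> C x -> nz X x -> exists b,
    [/\ nz X b, par X x b, ~ C b & F (adjoin C b)];
  rich_new : forall C, F C -> exists b,
    [/\ nz X b, forall x, C x -> nz X x -> ~~ par X x b & F (adjoin C b)];
  rich_out : forall C, F C -> exists b,
    (forall c, C c -> ~ Xspan X (c + b)) /\ F (adjoin C b) }.

Lemma ran_adjoin g a b : ran (adjoin g (a, b)) = adjoin (ran g) b.
Proof.
apply/seteqP; split=> [_ [_ [[c d] [l [gcd kl [_ ->]]]]]|_ [d [l [[c gcd] kl ->]]]].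
  by exists d, l; split=> //; exists c.
by exists (c + l *: a), (c, d), l.
Qed.

(** Smallness is asked of the range alone, since the targets of extensions only
have to avoid the range. *)
Definition good (F : set (set V)) (g : set (V * V)) : Prop :=
  F (ran g) /\ exists s, matching g s.

Section Extend.
Variables (F : set (set V)) (HF : rich F).

(** If the axis of [a] is matched, [m_rep] provides a vector of the corresponding
axis in the range, hence room for a new vector of this axis.  Otherwise a new
pair of axes is matched; by [m_rep] again, an axis that avoids the range is not
matched yet. *)
Lemma good_extend_axis g a : good F g -> nz X a ->
  exists g', [/\ good F g', g `<=` g' & dom g' a].
Proof.
move=> [Fg [s H]] na; have g0 := sp0 (m_sub H).
have [da|Na] := EM (dom g a); first by exists g; split=> //; split=> //; exists s.
have conclude b s' : F (adjoin (ran g) b) -> matching (adjoin g (a, b)) s' ->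
    exists g', [/\ good F g', g `<=` g' & dom g' a].
  move=> Fb H'; exists (adjoin g (a, b)); split; last by exists b; exact: adjoin_mem.
    by split; [rewrite ran_adjoin|exists s'].
  exact: adjoin_sub.
have [[x [x' [sx xa]]]|N] := EM (exists x x', s (x, x') /\ par X x a).
  have [z [z' [gz sz xz]]] := m_rep H sx.
  have [nx nx'] := m_nz (m_axis H) sx; have [nz_z nz_z'] := m_nz (m_axis H) sz.
  have [b [nb zb Nb Fb]] := rich_axis HF Fg (ex_intro _ z gz : ran g z') nz_z'.
  apply: (conclude b s Fb); apply: (matching_extend H) => //;
    [exact: m_axis H|exact: represented_adjoin H|left].
  apply: (m_sat (m_axis H) sz) => //; apply: par_trans (nx) (na) _ xa => //.
  by rewrite par_sym.
have [b [nb bnew Fb]] := rich_new HF Fg.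
pose s' : set (V * V) := s `|` [set z | [/\ nz X z.1, nz X z.2, par X a z.1 & par X b z.2]].
have s_a x x' : s (x, x') -> ~~ par X x a.
  by move=> sx; apply/negP => xa; apply: N; exists x, x'.
have s_b x x' : s (x, x') -> ~~ par X x' b.
  move=> sx; have [z [z' [gz sz xz]]] := m_rep H sx.
  have [nx nx'] := m_nz (m_axis H) sx; have [nz_z nz_z'] := m_nz (m_axis H) sz.
  have x'z' : par X x' z' by rewrite -(m_par (m_axis H) sx sz).
  have zb : ~~ par X z' b by apply: bnew => //; exists z.
  by apply: contra zb => x'b; apply: par_trans (nx') nb _ x'b => //; rewrite par_sym.
(* b is parallel to itself. *)
have Nb : ~ ran g b.
  by move=> rb; have := bnew b rb nb; rewrite par_refl //; case: nb.
have apart x x' y y' : s (x, x') -> nz X y -> nz X y' -> par X a y -> par X b y' ->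
    par X x y = false /\ par X x' y' = false.
  move=> sx ny ny' ay by'; have [nx nx'] := m_nz (m_axis H) sx.
  split; apply/negP => xy.
    have /negP := s_a _ _ sx; apply; apply: par_trans (nx) (ny) _ xy _ => //.
    by rewrite par_sym.
  have /negP := s_b _ _ sx; apply; apply: par_trans (nx') (ny') _ xy _ => //.
  by rewrite par_sym.
have sab : s' (a, b).
  right; split=> //=; apply: par_refl => //; [by case: na|by case: nb].
apply: (conclude b s' Fb).
have [nzs pars sats] := m_axis H.
apply: (matching_extend H) => //; last by left.
- by move=> z sz; left.
- split.
  + by move=> x x' [/nzs//|[]].
  + move=> x x' y y' [sx|[/= nx nx' ax bx']] [sy|[/= ny ny' ay by']].
    * exact: pars.
    * by have [-> ->] := apart _ _ _ _ sx ny ny' ay by'.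
    * by rewrite ![par X _ y]par_sym ![par X _ y']par_sym;
        have [-> ->] := apart _ _ _ _ sy nx nx' ax bx'.
    * transitivity true; [|symmetry].
        by apply: par_trans (nx) (na) ny _ ay => //; rewrite par_sym.
      by apply: par_trans (nx') (nb) ny' _ by' => //; rewrite par_sym.
  + move=> x x' y y' [sx|[/= nx nx' ax bx']] ny ny' xy xy'.
      by left; apply: sats sx ny ny' xy xy'.
    right; split=> //=; first exact: par_trans (na) (nx) (ny) ax xy.
    exact: par_trans (nb) (nx') (ny') bx' xy'.
- move=> x x' [/(m_rep H)[z [z' [gz sz xz]]]|[/= nx nx' ax bx']].
    by exists z, z'; split=> //; [exact: adjoin_sub|left].
  by exists a, b; split=> //; [exact: adjoin_mem|rewrite par_sym].
Qed.

Lemma good_extend_span g t : good F g -> (forall x, x \in t -> X x) ->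
  exists g', [/\ good F g', g `<=` g' & dom g' (\sum_(x <- t) x)].
Proof.
elim: t g => [|x t IH] g Gg Xt.
  exists g; split=> //; rewrite big_nil; exists 0.
  by case: Gg => _ [s /m_sub/sp0].
have [g1 [G1 gg1 [y1 d1]]] : exists g', [/\ good F g', g `<=` g' & dom g' x].
  have [x0|/eqP x0] := eqVneq x 0; last first.
    by apply: good_extend_axis => //; split=> //; apply: Xt; exact: mem_head.
  by exists g; split=> //; rewrite x0; exists 0; case: Gg => _ [s /m_sub/sp0].
have [|g2 [G2 gg2 [y2 d2]]] := IH g1 G1.
  by move=> y yt; apply: Xt; rewrite inE yt orbT.
exists g2; split=> //; first by move=> z /gg1/gg2.
rewrite big_cons; exists (y1 + y2); case: G2 => _ [s /m_sub/spD H].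
exact: (H _ _ (gg2 _ d1) d2).
Qed.

(** If a is congruent to an element of the span of X modulo the domain, the terms
of that element are adjoined one after another. *)
Lemma good_extend g a : good F g ->
  exists g', [/\ good F g', g `<=` g' & dom g' a].
Proof.
move=> Gg; have [[c [[d gcd] [n [t [_ Xt E]]]]]|N] :=
  EM (exists c, dom g c /\ Xspan X (c + a)).
  have [g' [G' gg' [y dy]]] := good_extend_span Gg Xt.
  exists g'; split=> //; exists (y + (-1) *: d).
  case: G' => _ [s /m_sub[_ gD gZ]].
  have -> : (a, y + -1 *: d) = (\sum_(x <- t) x, y) + (-1) *: (c, d).
    by rewrite -E; congr pair => /=; rewrite scaleN1r addrAC subrr add0r.
  apply: gD => //; apply: gZ; last exact: gg'.
  by apply: subN => //; exact: sub1.
have [Fg [s H]] := Gg; have [b [bout Fb]] := rich_out HF Fg.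
have aout c : dom g c -> ~ Xspan X (c + a) by move=> dc W; apply: N; exists c.
have g0 := sp0 (m_sub H); have N1 : k (-1) by apply: subN => //; exact: sub1.
have X0 : Xspan X 0 by apply: Xspan1; exact: axes0.
exists (adjoin g (a, b)); split; [|exact: adjoin_sub|by exists b; exact: adjoin_mem].
split; [by rewrite ran_adjoin|exists s; apply: (matching_extend H) => //].
- move=> [d gad]; apply: (aout (- a)); last by rewrite addNr.
  by exists (- d); have := spZ (m_sub H) N1 gad; rewrite -[X in g X]/(_, _) !scaleN1r.
- move=> [d gdb]; apply: (bout (- b)); last by rewrite addNr.
  by exists (- d); have := spZ (m_sub H) N1 gdb; rewrite -[X in g X]/(_, _) !scaleN1r.
- exact: m_axis H.
- exact: represented_adjoin H.
- by right.
Qed.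

Lemma good_extend_seq g (t : seq V) : good F g ->
  exists g', [/\ good F g', g `<=` g' & forall a, a \in t -> dom g' a].
Proof.
elim: t g => [|x t IH] g Gg; first by exists g; split.
have [g1 [G1 gg1 [y d1]]] := good_extend x Gg.
have [g2 [G2 gg2 d2]] := IH g1 G1.
exists g2; split=> //; first by move=> z /gg1/gg2.
move=> a; rewrite inE => /predU1P[->|/d2//]; exists y; exact: gg2.
Qed.

End Extend.

End BackAndForth.

(** * Countable closures and countable rich families *)

Lemma countable_enum (T : Type) (C : set T) (x : T) : countable C ->
  exists e : nat -> T, forall c, C c -> exists i, e i = c.
Proof.
move=> /countable_injP[f finj]; have /choice[e He] i : exists c, forall d, C d -> f d = i -> d = c.
  have [[d [Cd fd]]|N] := EM (exists d, C d /\ f d = i).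
    by exists d => d' Cd' fd'; apply: finj; rewrite ?inE // fd fd'.
  by exists x => d Cd fd; case: N; exists d.
by exists e => c Cc; exists (f c); apply/esym/He.
Qed.

Lemma countable_image (T U : Type) (f : T -> U) (C : set T) :
  countable C -> countable (f @` C).
Proof. by move=> cC; apply: sub_countable cC; exact: card_image_le. Qed.

Lemma countable_sub (T : Type) (B C : set T) : C `<=` B -> countable B -> countable C.
Proof. by move=> CB; apply: sub_countable; exact: subset_card_le. Qed.

Lemma countableU (T : Type) (B C : set T) :
  countable B -> countable C -> countable (B `|` C).
Proof.
by move=> cB cC; rewrite -bigcup2E; apply: bigcup_countable => // -[|[|i]] _.
Qed.

Lemma countable_closure (T : Type) (I : countType) (op : I -> T -> T -> T)
    (A : set T) : countable A -> exists B, [/\ countable B, A `<=` B &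
  forall i a b, B a -> B b -> B (op i a b)].
Proof.
move=> cA.
pose step (B : set T) := B `|`
  \bigcup_(i in [set: I]) ((fun z => op i z.1 z.2) @` (B `*` B)).
pose B m := iter m step A; exists (\bigcup_(m in [set: nat]) B m); split.
- apply: bigcup_countable => // m _; elim: m => //= m IH.
  apply: countableU => //; apply: bigcup_countable => // i _.
  by apply: countable_image; exact: countableX.
- by move=> a Aa; exists 0%N.
have mono m n : (m <= n)%N -> B m `<=` B n.
  move=> /subnK <-; elim: (n - m)%N => // p IH a /IH; rewrite addSn.
  by left.
move=> i a b [m _ Ba] [n _ Bb]; exists (maxn m n).+1 => //; right.
exists i => //; exists (a, b) => //; split=> /=.
  by apply: mono Ba; exact: leq_maxl.
by apply: mono Bb; exact: leq_maxr.
Qed.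

Lemma countable_subfield (K : fieldType) (A : set K) : countable A ->
  exists k, [/\ countable k, A `<=` k & subfield k].
Proof.
move=> cA.
pose op (i : option bool) (a b : K) : K :=
  match i with
  | None => a - b
  | Some true => a * b
  | Some false => a^-1
  end.
have [k [ck sk Hk]] := countable_closure op (countableU cA (countable1 (1 : K))).
have k1 : k 1 by apply: sk; right.
have k0 : k 0 by rewrite -(subrr (1 : K)); exact: (Hk None).
have kN a : k a -> k (- a) by move=> ka; rewrite -sub0r; exact: (Hk None).
exists k; split=> //; first by move=> a Aa; apply: sk; left.
split=> //.
- by move=> a b ka kb; rewrite -[b]opprK; apply: (Hk None) => //; exact: kN.
- exact: (Hk (Some true)).
- by move=> a ka; exact: (Hk (Some false) a a).
Qed.

Section Hulls.
Variables (K : fieldType) (V : lmodType K) (X : set V).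
Hypothesis HX : axes_system X.
Variables (k : set K) (kk : subfield k) (ck : countable k).

(** Subspaces that contain the components of their elements, so that the
identity on them is a matching. *)
Definition axis_closed (B : set V) : Prop := subspace k B /\
  forall b, B b -> Xspan X b -> exists t,
    (forall x, x \in t -> B x /\ X x) /\ b = \sum_(x <- t) x.

Lemma countable_adjoin (C : set V) b : countable C -> countable (adjoin k C b).
Proof.
move=> cC; apply: countable_sub (countable_image (fun z => z.1 + z.2 *: b) (countableX cC ck)).
by move=> _ [c [l [Cc kl ->]]]; exists (c, l).
Qed.

Lemma countable_hull (A : set V) : countable A ->
  exists B, [/\ countable B, A `<=` B & axis_closed B].
Proof.
move=> cA; have [e He] := countable_enum 0 ck.
have /choice[h Hh] a : exists t, Xspan X a ->
    (forall x, x \in t -> X x) /\ a = \sum_(x <- t) x.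
  have [[n [t [_ Xt E]]]|N] := EM (Xspan X a); first by exists t.
  by exists [::] => /N.
pose op (i : option (nat + nat)) (a b : V) : V :=
  match i with
  | None => a + b
  | Some (inl j) => e j *: a
  | Some (inr j) => nth 0 (h a) j
  end.
have [B [cB sB HB]] := countable_closure op (countableU cA (countable1 (0 : V))).
exists B; split=> //; first by move=> a Aa; apply: sB; left.
split; first split.
- by apply: sB; right.
- by move=> a b; exact: (HB None).
- by move=> c a /He[j <-] Ba; exact: (HB (Some (inl j)) a a).
move=> b Bb /Hh[Xh E]; exists (h b); split=> // x xh; split; last exact: Xh.
by rewrite -(nth_index 0 xh); exact: (HB (Some (inr _)) b b).
Qed.

Definition graph_id (B : set V) : set (V * V) := [set z | B z.1 /\ z.1 = z.2].

Lemma matching_graph_id B : axis_closed B -> exists s, matching X k (graph_id B) s.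
Proof.
move=> [[B0 BD BZ] clos].
exists [set z | exists x, [/\ B x, nz X x, nz X z.1 /\ nz X z.2, par X x z.1 & par X x z.2]].
split.
- split=> //= [[a a'] [b b'] [/= Ba <-] [/= Bb <-]|c [a a'] kc [/= Ba <-]].
    by split=> //; exact: BD.
  by split=> //; exact: BZ.
- by move=> a b [/= _ <-].
- split=> /=.
  + by move=> a b [x []].
  + move=> a b c d [x [_ nx [na nb] xa xb]] [y [_ ny [nc nd] yc yd]].
    apply/idP/idP => H.
      have xy : par X x y.
        have ac := par_trans HX nx na nc xa H; apply: par_trans ac _ => //.
        by rewrite par_sym.
      have xd := par_trans HX nx ny nd xy yd.
      by apply: par_trans (nb) nx nd _ xd => //; rewrite par_sym.
    have xy : par X x y.
      have xd := par_trans HX nx nb nd xb H; apply: par_trans xd _ => //.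
      by rewrite par_sym.
    have xc := par_trans HX nx ny nc xy yc.
    by apply: par_trans (na) nx nc _ xc => //; rewrite par_sym.
  + move=> a b c d [x [Bx nx [na nb] xa xb]] nc nd ac bd.
    exists x; split=> //; first exact: par_trans (nx) na nc xa ac.
    exact: par_trans (nx) nb nd xb bd.
- move=> a b [x [Bx nx [na nb] xa xb]]; exists x, x; split=> //.
    exists x; split=> //; apply: par_refl => //; by case: nx.
  by rewrite par_sym.
move=> a b [/= Ba <-] W; have {W} Wa : Xspan X a by case: W.
have [t [Ht E]] := clos a Ba Wa.
exists [seq (x, x) | x <- t & x != 0]; split.
  move=> _ /mapP[x + ->]; rewrite mem_filter => /andP[/eqP x0 /Ht[Bx Xx]].
  split=> //=; exists x; split=> //; exact: par_refl.
have E' : a = \sum_(x <- t | x != 0) x.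
  rewrite E (bigID (fun x => x != 0)) /= [X in _ + X]big1 ?addr0 //.
  by move=> y /negPn/eqP.
by rewrite sum_pair !big_map /= big_filter -E'.
Qed.

(** The graph of a matching is that of an injection. *)
Lemma matching_countable_dom g s : matching X k g s -> countable (ran g) ->
  countable (dom g).
Proof.
move=> H cr; have /choice[f Hf] b : exists a, ran g b -> g (a, b).
  by have [[a gab]|N] := EM (ran g b); [exists a|exists 0 => /N].
apply: countable_sub (countable_image f cr) => a [b gab].
exists b; first by exists a.
have gf : g (f b, b) by apply: Hf; exists a.
have N1 : k (-1) by apply: subN => //; exact: sub1.
have := spD (m_sub H) gf (spZ (m_sub H) N1 gab).
rewrite -[X in g X]/(_, _) /= !scaleN1r subrr => /(m_inj H)[_ /(_ erefl)].
by move/subr0_eq.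
Qed.

Hypothesis rich_countable : rich X k (fun C => countable C).

(** The targets demanded by one countable set are countably many, hence fit in a
countable closed subspace. *)
Lemma rich_step (C : set V) : countable C -> exists D, [/\ countable D,
  axis_closed D, C `<=` D &
  [/\ forall x, C x -> nz X x -> exists b, [/\ D b, nz X b, par X x b & ~ C b],
      exists b, [/\ D b, nz X b & forall x, C x -> nz X x -> ~~ par X x b] &
      exists b, D b /\ forall c, C c -> ~ Xspan X (c + b)]].
Proof.
move=> cC; have [n [nn Hn _]] := rich_new rich_countable cC.
have [o [Ho _]] := rich_out rich_countable cC.
have /choice[f Hf] x : exists b, C x -> nz X x -> [/\ nz X b, par X x b & ~ C b].
  have [[Cx nx]|N] := EM (C x /\ nz X x).
    by have [b [? ? ? _]] := rich_axis rich_countable cC Cx nx; exists b.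
  by exists 0 => ? ?; case: N.
have [D [cD sD clD]] : exists D, [/\ countable D,
    C `|` (f @` C `|` ([set n] `|` [set o])) `<=` D & axis_closed D].
  apply: countable_hull; do !apply: countableU => //; exact: countable_image.
exists D; split=> //; first by move=> x Cx; apply: sD; left.
split.
- move=> x Cx nx; have [? ? ?] := Hf x Cx nx; exists (f x); split=> //.
  by apply: sD; right; left; exists x.
- by exists n; split=> //; apply: sD; right; right; left.
- by exists o; split=> //; apply: sD; right; right; right.
Qed.

(** Along the chain obtained by iterating [rich_step], the subsets of members of
the chain form a rich family, and all targets stay in the union [E] of the
chain. *)
Lemma countable_rich_family (A : set V) : countable A -> exists F B E,
  [/\ rich X k F, F B, axis_closed B, A `<=` B &
      countable E /\ forall C, F C -> C `<=` E].
Proof.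
move=> /countable_hull[B [cB AB clB]].
have /choice[next Hnext] (C : {C : set V | countable C /\ axis_closed C}) :=
  rich_step (svalP C).1.
have next_ok C : countable (next C) /\ axis_closed (next C) by case: (Hnext C).
pose B_ m := iter m (fun C => exist _ (next C) (next_ok C))
  (exist (fun C => countable C /\ axis_closed C) B (conj cB clB)).
have BS m : sval (B_ m.+1) = next (B_ m) by [].
have Bsub m : sval (B_ m) `<=` sval (B_ m.+1).
  by rewrite BS; case: (Hnext (B_ m)).
have adj m C b : C `<=` sval (B_ m) -> sval (B_ m.+1) b ->
    adjoin k C b `<=` sval (B_ m.+1).
  move=> CB Bb _ [c [l [Cc kl ->]]]; have [_ [[_ BD BZ] _]] := svalP (B_ m.+1).
  by apply: BD; [apply/Bsub/CB|exact: BZ].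
exists (fun C => exists m, C `<=` sval (B_ m)), B, (\bigcup_m sval (B_ m)).
split=> //; [split| |split].
- move=> C x [m CB] Cx nx; have [_ _ _ [H _ _]] := Hnext (B_ m).
  have [b [Db nb xb Nb]] := H x (CB _ Cx) nx; exists b; split=> //.
    by move=> /CB.
  by exists m.+1; apply: adj => //; rewrite BS.
- move=> C [m CB]; have [_ _ _ [_ [b [Db nb Nb]] _]] := Hnext (B_ m).
  exists b; split=> // [x /CB|]; first exact: Nb.
  by exists m.+1; apply: adj => //; rewrite BS.
- move=> C [m CB]; have [_ _ _ [_ _ [b [Db Nb]]]] := Hnext (B_ m).
  exists b; split=> // [c /CB|]; first exact: Nb.
  by exists m.+1; apply: adj => //; rewrite BS.
- by exists 0%N.
- by apply: bigcup_countable => // m _; case: (svalP (B_ m)).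
- by move=> C [m CB] x /CB; exists m.
Qed.

End Hulls.

(** * Models of T_K as vector spaces with axes *)

Lemma pigeonhole k (P : nat -> nat -> Prop) :
  (forall i, (i < k.+2)%N -> exists2 j, (j <= k)%N & P i j) ->
  exists i i' j, [/\ (i < i' < k.+2)%N, P i j & P i' j].
Proof.
move=> H.
have /choice[g Hg] (i : 'I_k.+2) : exists j : 'I_k.+1, P i j.
  by have [j jk Pij] := H i (ltn_ord i); exists (Ordinal (jk : (j < k.+1)%N)).
have [i [i' [neq E]]] : exists i i', i != i' /\ g i = g i'.
  apply: contrapT => N.
  have ginj : injective g.
    move=> i i' E; apply/eqP; apply: contrapT => /negP neq.
    by apply: N; exists i, i'.
  by have := leq_card g ginj; rewrite !card_ord ltnn.
have [lt|] := ltnP i i'.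
  by exists i, i', (g i); split=> //; [rewrite lt ltn_ord|rewrite E].
rewrite leq_eqVlt val_eqE eq_sym (negPf neq) /= => lt.
by exists i', i, (g i); split=> //; [rewrite lt ltn_ord|rewrite E].
Qed.

Section Avoidance.
Variables (K : fieldType) (V : lmodType K) (X : set V).
Hypothesis HX : axes_system X.

(** The scalar multiples of [x] already provide infinitely many vectors, as K is
infinite. *)
Lemma avoid_in_axis x (c : seq V) : infinite_set [set: K] -> nz X x ->
  exists b, [/\ nz X b, par X x b & b \notin c].
Proof.
move=> infK nx; have [Xx x0] := nx.
have fin : finite_set [set l : K | l *: x \in 0 :: c].
  apply: (finite_preimage (B := [set` (0 :: c)])); last exact: finite_seq.
  move=> l m _ _ /eqP; rewrite -subr_eq0 -scalerBl scaler_eq0 subr_eq0.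
  by case/orP => /eqP.
have [l /= Nl] : [set: K] `\` [set l : K | l *: x \in 0 :: c] !=set0.
  by apply/set0P/negP => /eqP E; apply: infK; apply: sub_finite_set fin; rewrite -setD_eq0.
case: Nl => _ /negP; rewrite inE negb_or => /andP[lx0 lxc].
exists (l *: x); split=> //; last exact: parZ.
by split; [exact: axesZ|exact/eqP].
Qed.

Definition many_axes := forall n, exists f : nat -> V,
  (forall i, (i < n)%N -> nz X (f i)) /\
  (forall i j, (i < j < n)%N -> ~~ par X (f i) (f j)).

(** If each of [k + 2] distinct axes contained some nonzero [c j], two of them would
share the same one. *)
Lemma avoid_axes (c : nat -> V) k : many_axes -> exists b, nz X b /\
  forall j, (j <= k)%N -> nz X (c j) -> ~~ par X (c j) b.
Proof.
move=> /(_ k.+2)[f [nf pf]]; apply: contrapT => N.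
have [|i [i' [j [/andP[ii' ik] [nj ji] [_ ji']]]]] :=
    @pigeonhole k (fun i j => nz X (c j) /\ par X (c j) (f i)).
  move=> i ik; apply: contrapT => N'; apply: N; exists (f i); split; first exact: nf.
  by move=> j jk nj; apply/negP => cf; apply: N'; exists j.
have /negP := pf i i' (introT andP (conj ii' ik)); apply.
apply: par_trans (nf _ (ltn_trans ii' ik)) nj (nf _ ik) _ ji' => //.
by rewrite par_sym.
Qed.

(** Take [k + 2] partial sums of a sequence of vectors on distinct axes, with more
than [2k] terms between any two of them.  If each of them failed, two would fail
for the same [c j], and their difference would be in X^(2k). *)
Lemma avoid_Xsum (c : nat -> V) k : many_axes -> exists b,
  forall j, (j <= k)%N -> ~ Xsum X k (c j + b).
Proof.
pose d := (k + k).+1.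
move=> /(_ (k.+1 * d).+1)[f [nf pf]]; apply: contrapT => N.
pose e m := \sum_(0 <= i < m * d) f i.
have [|m [m' [j [/andP[mm' mk] jm jm']]]] :=
    @pigeonhole k (fun m j => Xsum X k (c j + e m)).
  move=> m mk; apply: contrapT => N'; apply: N; exists (e m).
  by move=> j jk H; apply: N'; exists j.
have E : (c j + e m') + (-1) *: (c j + e m) = \sum_(m * d <= i < m' * d) f i.
  rewrite scaleN1r opprD addrACA subrr add0r /e.
  rewrite (@big_cat_nat _ _ _ (m * d)) //= ?leq_mul2r ?(ltnW mm') ?orbT //.
  by rewrite addrAC subrr add0r.
have [t [szt Xt Et]] := XsumD jm' (XsumZ HX (-1) jm).
have lt_k i : (i < m' * d)%N -> (i < (k.+1 * d).+1)%N.
  by move=> im; rewrite ltnS ltnW // (leq_trans im) // leq_mul2r -ltnS mk orbT.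
have := @separated_size _ _ _ HX [seq f i | i <- index_iota (m * d) (m' * d)] t.
rewrite size_map size_iota szt -mulnBl big_map -Et E => H.
suff : ((m' - m) * d <= k + k)%N.
  by rewrite leqNgt [(_ < _)%N](leq_pmull d) // subn_gt0.
apply: H => //.
- move=> _ /mapP[i + ->]; rewrite mem_index_iota => /andP[_ im].
  exact/nf/lt_k.
- rewrite /separated pairwise_map.
  apply: (sub_in_pairwise (P := fun i => (i < m' * d)%N) (r := ltn)).
  + by move=> i l _ lm il; apply: pf; apply/andP; split=> //; exact: lt_k.
  + by apply/allP => i; rewrite mem_index_iota => /andP[].
  + by rewrite -sorted_pairwise ?iota_ltn_sorted //; exact: ltn_trans.
Qed.

End Avoidance.

Section VectorSpace.
Variables (K : fieldType) (M : structure (LK K)).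

(** The proof [vs] is an argument so that the vector space structure can be
attached to the type. *)
Definition vectors (vs : vector_space M) : Type := carrier M.

Section Instances.
Variable vs : vector_space M.

HB.instance Definition _ := gen_eqMixin (vectors vs).
HB.instance Definition _ := gen_choiceMixin (vectors vs).
HB.instance Definition _ := GRing.isZmodule.Build (vectors vs)
  (vaddA vs) (vaddC vs) (vadd0 vs) (vaddN vs).
HB.instance Definition _ := GRing.Zmodule_isLmodule.Build K (vectors vs)
  (vscaleA vs) (vscale1 vs) (vscaleDr vs)
  (fun v c d => vscaleDl vs c d v).

End Instances.

Hypothesis HM : TK_axioms M.
Let V := vectors (ax_vs HM).
Definition model_X : set V := mX 1.

Lemma mX_Xsum n (a : V) : mX n a <-> Xsum model_X n a.
Proof.
rewrite (ax_Xn HM); split=> [[x Xx ->]|[s [sz Xs ->]]].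
  exists [seq x i | i <- index_enum 'I_n]; rewrite size_map big_map; split=> //.
    by rewrite -[RHS]card_ord cardE enumT /index_enum; case: index_enum_key.
  by move=> _ /mapP[i _ ->]; exact: Xx.
exists (fun i : 'I_n => nth 0 s i).
  by move=> i; apply: Xs; rewrite mem_nth // sz.
by rewrite -sz (big_nth 0) big_mkord.
Qed.

Lemma model_axes_system : axes_system model_X.
Proof.
split.
- have [a [Xa _]] : exists a : M, nzX a.
    have [f f0 _] := (inf_axesP (ax_par_refl HM) (ax_par_sym HM) (ax_par_trans HM)).1
      (ax_inf_axes HM) 1%N.
    by exists (f 0%N); exact: (f0 ord0).
  rewrite -(scale0r (a : V)); exact: (ax_scaleX HM 0 Xa).
- by move=> c a; exact: (ax_scaleX HM).
- move=> a b c Xa a0 Xb b0 Xc c0 ab bc.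
  exact: (ax_par_trans HM (conj Xa a0) (conj Xb b0) (conj Xc c0) ab bc).
move=> s s0 Xs seps E.
have [n sz] : exists n, size s = n.+1 by case: s s0 {Xs seps E} => // x s; exists (size s).
have H := (indepP (ax_par_refl HM) (ax_par_sym HM) (ax_par_trans HM) n).1 (@ax_indep _ _ HM n).
have nth_in i : (i < n.+1)%N -> nth 0 s i \in s by move=> ?; rewrite mem_nth // sz.
suff : (1 : K) = 0 by move/eqP; rewrite oner_eq0.
apply: (H (nth (0 : V) s) _ _ (fun=> 1) _ ord0).
- by move=> i; exact: (Xs _ (nth_in _ (ltn_ord i))).
- move=> i j ij.
  have Nij (p q : nat) : (p < q < n.+1)%N -> ~ model_X (nth 0 s p + nth 0 s q).
    move=> /andP[pq qn]; apply/asboolPn.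
    move/(pairwiseP 0): seps; apply=> //; rewrite inE sz //; exact: ltn_trans pq qn.
  have [lt|] := ltnP i j; first by apply: (Nij i j); rewrite lt ltn_ord.
  rewrite leq_eqVlt val_eqE eq_sym (negPf ij) /= => lt ij'.
  apply: (Nij j i); first by rewrite lt ltn_ord.
  by rewrite addrC.
- rewrite -[RHS]E [RHS](big_nth 0) sz [RHS]big_mkord; apply: eq_bigr => i _.
  exact: (scale1r (nth (0 : V) s i)).
Qed.

Lemma model_many_axes : many_axes model_X.
Proof.
move=> n; have [f nf pf] :=
  (inf_axesP (ax_par_refl HM) (ax_par_sym HM) (ax_par_trans HM)).1 (ax_inf_axes HM) n.
exists f; split=> [i lt|i j /andP[ij jn]]; first exact: (nf (Ordinal lt)).
apply/parP; apply: (pf (Ordinal (ltn_trans ij jn)) (Ordinal jn)).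
by rewrite -val_eqE /= neq_ltn ij.
Qed.

End VectorSpace.

(** * Formulas over a subfield and back-and-forth *)

Section Scalars.
Variable K : fieldType.

Fixpoint term_over (k : set K) (t : term (LK K)) : Prop :=
  match t with
  | tVar _ => True
  | tApp f ts =>
      match f with Scale c => k c | _ => True end /\ forall i, term_over k (ts i)
  end.

Fixpoint formula_over (k : set K) (p : formula (LK K)) : Prop :=
  match p with
  | fFalse => True
  | fEq t u => term_over k t /\ term_over k u
  | fRel _ ts => forall i, term_over k (ts i)
  | fImp p q => formula_over k p /\ formula_over k q
  | fAll _ p => formula_over k p
  end.

Lemma term_over_sub (k k' : set K) t : k `<=` k' -> term_over k t -> term_over k' t.
Proof.
move=> kk'; elim: t => //= f ts IH [Hf Hts]; split; last by move=> i; apply: IH.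
by case: f Hf {ts IH Hts} => //= c; exact: kk'.
Qed.

Lemma formula_over_sub (k k' : set K) p :
  k `<=` k' -> formula_over k p -> formula_over k' p.
Proof.
move=> kk'; elim: p => [|t u|r ts|p IHp q IHq|y p IH] //=.
- by move=> [? ?]; split; exact: term_over_sub kk' _.
- by move=> H i; exact: term_over_sub kk' (H i).
- by move=> [/IHp ? /IHq ?].
Qed.

Lemma countable_choice (I : countType) (P : I -> set K -> Prop) :
  (forall i k k', k `<=` k' -> P i k -> P i k') ->
  (forall i, exists2 k : set K, countable k & P i k) ->
  exists2 k : set K, countable k & forall i, P i k.
Proof.
move=> mono H; have /choice[k Hk] i : exists k, countable k /\ P i k.
  by have [k ck Pk] := H i; exists k.
exists (\bigcup_(i in [set: I]) k i).
  by apply: bigcup_countable => // i _; case: (Hk i).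
by move=> i; apply: mono (Hk i).2 => c kc; exists i.
Qed.

Lemma countable_term_scalars t : exists2 k : set K, countable k & term_over k t.
Proof.
elim: t => [x|f ts IH]; first by exists set0.
have [k ck Hk] := countable_choice (fun i k k' => @term_over_sub k k' (ts i)) IH.
exists (k `|` [set c | f = Scale c]) => /=.
  apply: countableU => //; case: f {ts IH Hk} => [||c].
  - by apply: countable_sub (countable0 K) => c.
  - by apply: countable_sub (countable0 K) => c.
  - by apply: countable_sub (countable1 c) => d [].
split; first by case: f {ts IH Hk} => //= c; right.
by move=> i; apply: term_over_sub (Hk i) => c; left.
Qed.

Lemma countable_formula_scalars p :
  exists2 k : set K, countable k & formula_over k p.
Proof.
elim: p => [|t u|r ts|p [k ck kp] q [l cl lq]|y p //]; first by exists set0.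
- have [k ck kt] := countable_term_scalars t.
  have [l cl lu] := countable_term_scalars u.
  exists (k `|` l); first exact: countableU.
  by split; [apply: term_over_sub kt|apply: term_over_sub lu] => c; [left|right].
- exact: (countable_choice (fun i k k' => @term_over_sub k k' (ts i))
           (fun i => countable_term_scalars (ts i))).
- exists (k `|` l); first exact: countableU.
  by split; [apply: formula_over_sub kp|apply: formula_over_sub lq] => c; [left|right].
Qed.

End Scalars.

Section EF.
Variables (K : fieldType) (N : structure (LK K)) (HN : TK_axioms N).
Let V := vectors (ax_vs HN).
Let X : set V := @model_X K N HN.
Let HX := model_axes_system HN.
Variables (k : set K) (kk : subfield k).

Lemma finterp_Add (xs : 'I_2 -> N) :
  finterp (s := N) (f := (Add K : Defs.fsym (LK K))) xs = vadd (xs ord0) (xs ord_max).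
Proof.
congr finterp; apply/funext => i.
by case: (unliftP ord0 i) => [j|] -> //=; congr xs; apply: val_inj; rewrite /= [j]ord1.
Qed.

Lemma finterp_Zero (xs : 'I_0 -> N) :
  finterp (s := N) (f := (Zero K : Defs.fsym (LK K))) xs = vzero N.
Proof. by congr finterp; apply/funext => -[]. Qed.

Lemma finterp_Scale c (xs : 'I_1 -> N) :
  finterp (s := N) (f := (Scale c : Defs.fsym (LK K))) xs = vscale c (xs ord0).
Proof. by congr finterp; apply/funext => i; rewrite [i]ord1. Qed.

Lemma rinterp_mX n (xs : 'I_1 -> N) :
  rinterp (s := N) (r := (n : Defs.rsym (LK K))) xs = mX n (xs ord0).
Proof. by congr rinterp; apply/funext => i; rewrite [i]ord1. Qed.

Lemma eval_graph (g : set (V * V)) (v w : nat -> N) t : subspace k g ->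
  (forall x, g (v x, w x)) -> term_over k t -> g (eval v t, eval w t).
Proof.
move=> [g0 gD gZ] vw; elim: t => [x _|[||c] ts IH [kf kts]] /=; first exact: vw.
- by rewrite !finterp_Add; exact: gD (IH _ (kts _)) (IH _ (kts _)).
- by rewrite !finterp_Zero.
- by rewrite !finterp_Scale; exact: gZ kf (IH _ (kts _)).
Qed.

Hypothesis rich_V : rich X k (fun C => countable C).

Lemma good_swap g : good X k (fun C => countable C) g ->
  good X k (fun C => countable C) (swap g).
Proof.
move=> [cg [s H]]; split; last by exists (swap s); exact: matching_swap.
exact: (matching_countable_dom kk H cg).
Qed.

(** Atomic formulas are preserved because matchings are linear bijections that
preserve every X^n, and quantifiers because matchings can be extended on either
side. *)
Theorem back_and_forth g (v w : nat -> N) p :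
  good X k (fun C => countable C) g -> (forall x, g (v x, w x)) ->
  formula_over k p -> sat v p <-> sat w p.
Proof.
elim: p g v w => [|t u|r ts|p IHp q IHq|y p IH] g v w Gg vw //=.
- move=> [kt ku]; have [_ [s H]] := Gg.
  have gt := eval_graph (m_sub H) vw kt.
  have gu := eval_graph (m_sub H) vw ku.
  have N1 : k (-1) by apply: subN => //; exact: sub1.
  have := spD (m_sub H) gt (spZ (m_sub H) N1 gu).
  rewrite -[X in g X]/(_, _) /= !scaleN1r => /(m_inj H) E.
  by split=> E'; apply: (@subr0_eq V); apply/E; rewrite E'; exact: (@subrr V).
- move=> /(_ ord0) kt; have [_ [s H]] := Gg.
  have gt := eval_graph (m_sub H) vw kt.
  rewrite (rinterp_mX r (fun i => eval v (ts i))) (rinterp_mX r (fun i => eval w (ts i))).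
  rewrite !(@mX_Xsum K N HN); split; first exact: matching_Xsum H gt.
  have H' := matching_swap H; apply: (matching_Xsum HX H'); exact: gt.
- move=> [kp kq]; have := IHp g v w Gg vw kp; have := IHq g v w Gg vw kq; tauto.
have half g' (v' w' : nat -> N) : good X k (fun C => countable C) g' ->
    (forall x, g' (v' x, w' x)) -> formula_over k p ->
    (forall a, sat (upd w' y a) p) -> forall a, sat (upd v' y a) p.
  move=> Gg' vw' kp Hw a; have [g1 [G1 gg1 [b g1ab]]] := good_extend HX kk rich_V a Gg'.
  apply/(IH g1 _ (upd w' y b) G1 _ kp); last exact: Hw.
  by move=> x; rewrite /upd; case: ifP => // _; exact: gg1.
move=> kp; split; last exact: half Gg vw kp.
by apply: half (good_swap Gg) _ kp => x; exact: vw.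
Qed.

End EF.

(** * Richness of ultrapowers and the count of types *)

Section Ultra.
Variables (K : fieldType) (infK : infinite_set [set: K]).
Variables (M : structure (LK K)) (HM : TK_axioms M).
Variables (U : set_system nat) (UU : UltraFilter U).
Hypothesis free_U : \oo `<=` U.
Let N : structure (LK K) := ultrapower M U.
Variable HN : TK_axioms N.
Let V := vectors (ax_vs HM).
Let W := vectors (ax_vs HN).
Let X : set V := @model_X K M HM.
Let Y : set W := @model_X K N HN.
Let HX := model_axes_system HM.

#[local] Instance ultra_proper_U' : ProperFilter U := @ultra_proper _ U UU.

Definition germV (f : nat -> V) : W := germ U f.

Lemma germVD f g : germV f + germV g = germV (fun i => f i + g i).
Proof.
pose xs (i : 'I_2) := if val i == 0%N then f else g.
rewrite [RHS](_ : _ = germ U (fun k =>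
  finterp (f := (Add K : Defs.fsym (LK K))) (fun i => xs i k))); last first.
  congr (germ U _); apply/funext => k; rewrite finterp_Add //.
rewrite -(finterp_germ UU (f := (Add K : Defs.fsym (LK K))) xs).
by rewrite finterp_Add.
Qed.

Lemma germV0 : 0 = germV (fun=> 0).
Proof.
have := finterp_germ UU (f := (Zero K : Defs.fsym (LK K))) (@noarg (nat -> M)).
rewrite finterp_Zero => E; rewrite -[LHS]/(vzero N) E.
by congr (germ U _); apply/funext => k; rewrite finterp_Zero.
Qed.

Lemma germV_eq0 f : germV f = 0 <-> U [set i | f i = 0].
Proof. rewrite germV0; exact: (germ_eq UU). Qed.

Lemma mX_germ n f : mX (M := N) n (germ U f) <-> U [set i | mX n (f i)].
Proof.
exact: (rinterp_germ UU (r := (n : Defs.rsym (LK K))) (fun _ => f)).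
Qed.

Lemma germV_Xsum n f : Xsum Y n (germV f) <-> U [set i | Xsum X n (f i)].
Proof.
rewrite -(@mX_Xsum K N HN) mX_germ.
by split; apply: filterS => i /(@mX_Xsum K M HM).
Qed.

Lemma germV_nz f : nz Y (germV f) <-> U [set i | nz X (f i)].
Proof.
rewrite /nz germV_eq0 -ultra_not; split=> [[H1 H2]|H].
  by move/(mX_germ 1): H1 => H1; apply: filterS (filterI H1 H2).
by split; [apply/(mX_germ 1)|]; apply: filterS H => i [].
Qed.

Lemma germV_par f g : par Y (germV f) (germV g) <-> U [set i | par X (f i) (g i)].
Proof.
split=> [/parP|H].
  by rewrite germVD => /(mX_germ 1); apply: filterS => i H; apply/parP.
by apply/parP; rewrite germVD; apply/(mX_germ 1); apply: filterS H => i /parP.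
Qed.

Lemma countable_germs (C : set W) : countable C -> exists c : nat -> nat -> V,
  forall x, C x -> exists i, germV (c i) = x.
Proof.
move=> cC; have [e He] := countable_enum 0 cC.
exists (fun i => germ_rep (e i)) => x /He[i <-]; exists i.
exact: germ_repK.
Qed.

Variables (k : set K) (ck : countable k).

(** In each of the three cases [ultra_diagonal] reduces the avoidance of a
countable set to the avoidance of a finite one in every coordinate. *)
Lemma ultrapower_rich : rich Y k (fun C => countable C).
Proof.
split=> [C x cC Cx|C cC|C cC]; have [c Hc] := countable_germs cC.
- have [i <-] := Hc x Cx; set f := c i => /germV_nz nf.
  have [|b Hb] := ultra_diagonal UU free_U
      (Q := fun j i (b : V) => [/\ nz X b, par X (f i) b & b <> c j i]).
    apply: filterS nf => n nf.
    have [b [nb fb Nb]] := avoid_in_axis HX [seq c j n | j <- iota 0 n.+1] infK nf.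
    exists b => j jn; split=> // E; move/negP: Nb; apply; rewrite E.
    by apply/mapP; exists j; rewrite // mem_iota.
  exists (germV b); split.
  + by apply/germV_nz; apply: filterS (Hb 0%N) => n [].
  + by apply/germV_par; apply: filterS (Hb 0%N) => n [].
  + move=> /Hc[j /(germ_eq UU) E]; apply: (ultra_false UU).
    by apply: filterS (filterI E (Hb j)) => n [/= -> []].
  + exact: countable_adjoin.
- have [|b Hb] := ultra_diagonal UU free_U
      (Q := fun j i (b : V) => nz X b /\ (nz X (c j i) -> ~~ par X (c j i) b)).
    apply: filterS filterT => n _.
    have [b [nb Nb]] := avoid_axes HX (c^~ n) n (@model_many_axes K M HM).
    by exists b => j jn; split=> //; exact: Nb.
  exists (germV b); split.
  + by apply/germV_nz; apply: filterS (Hb 0%N) => n [].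
  + move=> x /Hc[j <-] /germV_nz nc; apply/negP => /germV_par cb.
    apply: (ultra_false UU).
    apply: filterS (filterI nc (filterI cb (Hb j))) => n [/= n1 [n2 [_ n3]]].
    by move: (n3 n1); rewrite n2.
  + exact: countable_adjoin.
- have [|b Hb] := ultra_diagonal UU free_U
      (Q := fun j i (b : V) => ~ Xsum X i (c j i + b)).
    apply: filterS filterT => n _.
    exact: (avoid_Xsum HX (c^~ n) n (@model_many_axes K M HM)).
  exists (germV b); split; last exact: countable_adjoin.
  move=> x /Hc[j <-] [m]; rewrite germVD => /germV_Xsum Hm.
  apply: (ultra_false UU).
  apply: filterS (filterI (ultra_ge free_U m) (filterI Hm (Hb j))) => n [/= mn [n1]].
  by apply; apply: Xsum_pad n1.
Qed.

End Ultra.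

(** Cantor's diagonal argument: a function to a countable type is not injective
on the branches. *)
Lemma uncountable_cantor (D : countType) (f : (nat -> bool) -> D) :
  exists s t, s <> t /\ f s = f t.
Proof.
apply: contrapT => N.
have finj s t : f s = f t -> s = t.
  by move=> E; apply: contrapT => st; apply: N; exists s, t.
have /choice[g Hg] i : exists s, forall t, pickle (f t) = i -> t = s.
  have [[s <-]|N'] := EM (exists s, pickle (f s) = i).
    by exists s => t /(pcan_inj pickleK)/finj.
  by exists (fun=> false) => t E; case: N'; exists t.
pose d i := ~~ g i i.
have := Hg (pickle (f d)) d erefl.
move/(congr1 (fun s => s (pickle (f d)))); rewrite {1}/d.
by case: (g _ _).
Qed.

Fixpoint prefix_of (s : nat -> bool) (m : nat) : seq bool :=
  if m is j.+1 then rcons (prefix_of s j) (s j) else [::].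

Lemma first_difference (s t : nat -> bool) : s <> t ->
  exists m, prefix_of s m = prefix_of t m /\ s m <> t m.
Proof.
move=> st; have ex_diff : exists m, s m != t m.
  by apply: contrapT => N; apply: st; apply/funext => m; apply/eqP/negPn/negP => st;
    apply: N; exists m.
case: (ex_minnP ex_diff) => i /eqP si mini; exists i; split=> //.
suff H j : (j <= i)%N -> prefix_of s j = prefix_of t j by exact: H.
elim: j => //= j IH ji; rewrite IH ?(ltnW ji) //; congr rcons.
by apply/eqP/negPn/negP => /mini; rewrite leqNgt ji.
Qed.

(** Each branch [s] is realised in the ultrapower by the germ [c s], and [c s] is
moved by a matching that fixes the parameters to a tuple of the countable set
[E].  Two branches that receive the same tuple of [E] satisfy the same formulas
of the tree, although they pass through incompatible nodes. *)
Lemma TK_no_unranked (K : fieldType) (M : structure (LK K)) n (p : pformula M) :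
  infinite_set [set: K] -> models M (@TK K) -> ~ unranked n p.
Proof.
move=> infK modM /unranked_tree[T [cT subT disjT]].
have [U UU free_U] := free_ultrafilter.
have proper_U : ProperFilter U := @ultra_proper _ U UU.
pose N := ultrapower M U.
have HM : TK_axioms M by apply/TK_modelsP.
have HN : TK_axioms N by apply/TK_modelsP; exact: models_ultrapower.
have [k [ck Hk kk]] : exists k : set K, [/\ countable k,
    forall w, formula_over k (pf_formula (T w)) & subfield k].
  have [k0 ck0 Hk0] := countable_choice
    (fun w k k' => @formula_over_sub K k k' (pf_formula (T w)))
    (fun w => countable_formula_scalars (pf_formula (T w))).
  have [k [ck kk0 kk]] := countable_subfield ck0.
  by exists k; split=> // w; apply: formula_over_sub kk0 (Hk0 w).
pose W := vectors (ax_vs HN).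
have richW := @ultrapower_rich K infK M HM U UU free_U HN k ck.
have HY := model_axes_system HN.
pose param w x : W := germ U (fun=> pf_param (T w) x).
have cA : countable [set param z.1 z.2 | z in [set: seq bool * nat]].
  exact/countable_image/countableP.
have [F [B [E [richF FB clB AB [cE FE]]]]] := countable_rich_family ck richW cA.
have [e He] := countable_enum (0 : W) cE.
have subT' s i j (a : 'I_n -> M) : (i <= j)%N ->
    psat (T (prefix_of s j)) a -> psat (T (prefix_of s i)) a.
  move=> /subnK <-; elim: (j - i)%N => // m IH; rewrite addSn /= => /subT.
  exact: IH.
have /choice[a Ha] (z : (nat -> bool) * nat) :
  exists a : 'I_n -> M, psat (T (prefix_of z.1 z.2)) a by exact: cT.
pose c s (i : 'I_n) : W := germ U (fun j => a (s, j) i).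
pose valuation w (d : 'I_n -> W) x : W := if insub x is Some i then d i else param w x.
have sat_c s w : sat (M := N) (valuation w (c s)) (pf_formula (T w)) <->
    U [set j | psat (T w) (a (s, j))].
  have -> : valuation w (c s) = fun x => germ U (fun j =>
      if insub x is Some i then a (s, j) i else pf_param (T w) x).
    by apply/funext => x; rewrite /valuation; case: insub.
  exact: (Los UU).
have branch s m : U [set j | psat (T (prefix_of s m)) (a (s, j))].
  by apply: filterS (ultra_ge free_U m) => j mj; exact: subT' mj (Ha (s, j)).
(* The identity of B fixes the parameters.  It is extended to the coordinates of
   c s with targets in E, whose elements are named by their index along e. *)
have conjugate_in_E s : exists (d : n.-tuple nat) g,
    good (@model_X K N HN) k (fun C => countable C) g /\
    (forall b, B b -> g (b, b)) /\ forall i, g (c s i, e (tnth d i)).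
  have [sg Hsg] := matching_graph_id HY clB.
  have G0 : good (@model_X K N HN) k F (graph_id B).
    split; last by exists sg.
    rewrite (_ : ran _ = B) //; apply/seteqP; split=> [b [b' [/= Bb <-]]|b Bb] //.
    by exists b.
  have [g [[Fg Mg] sub dg]] := good_extend_seq HY kk richF [seq c s i | i <- enum 'I_n] G0.
  have /choice[d Hd] i : exists j, g (c s i, e j).
    have [b gb] : dom g (c s i) by apply: dg; apply/mapP; exists i; rewrite ?mem_enum.
    have [j Ej] : exists j, e j = b by apply/He/(FE _ Fg); exists (c s i).
    by exists j; rewrite Ej.
  exists [tuple d i | i < n], g; split.
    by split=> //; apply: countable_sub cE; exact: FE.
  by split=> [b Bb|i]; [exact: sub|rewrite tnth_mktuple].
have /choice[d Hd] := conjugate_in_E.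
have [s [t [st dst]]] := uncountable_cantor d.
have same s' w : sat (M := N) (valuation w (c s')) (pf_formula (T w)) <->
    sat (M := N) (valuation w (fun i => e (tnth (d s') i))) (pf_formula (T w)).
  have [g [Gg [gB gc]]] := Hd s'.
  apply: (back_and_forth kk richW Gg) => // x; rewrite /valuation.
  by case: insub => [i|]; [exact: gc|apply: gB; apply: AB; exists (w, x)].
have [m [pst sm]] := first_difference st.
have := branch t m.+1; rewrite -sat_c same -dst -same sat_c => Hs.
apply: (ultra_false UU); apply: filterS (filterI Hs (branch s m.+1)) => j [/=].
rewrite -pst; have := disjT (prefix_of s m) (a (s, j)).
by case: (s m) (t m) sm => -[] //; tauto.
Qed.

Theorem corollary3p13 (K : fieldType) (infK : infinite_set [set: K]%classic) :
  totally_transcendental (@TK K).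
Proof.
move=> M modM _ n p cp; apply: MR_eq_exists => //.
exact: TK_no_unranked.
Qed.
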